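(* Let $\mathfrak g$ be a symmetrizable Kac-Moody algebra with root system $\Delta$, positive roots $\Delta^+$, and $\Delta^-=-\Delta^+$. (1) For any real closed subroot system $\Psi$ of $\Delta$ we have $\mathfrak g(\Psi)=\mathfrak g(\Pi(\Psi))$. (2) Let $\Sigma$ be a $\pi$-system of $\Delta$. Then $\Delta(\mathfrak g(\Sigma))\cap\Delta^{\pm}$ is contained in the $\mathbb Z_{\pm}$-span of $\Sigma$; that is, $\Delta(\mathfrak g(\Sigma))\cap\Delta^{+}$ is contained in the $\mathbb Z_{+}$-span of $\Sigma$ and $\Delta(\mathfrak g(\Sigma))\cap\Delta^{-}$ is contained in the $\mathbb Z_{-}$-span of $\Sigma$. (3) For any real closed subroot system $\Psi$ of $\Delta$ we have $\Psi=\Delta(\mathfrak g(\Psi))^{\mathrm{re}}$.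
   Context: $\mathfrak g$ is a (complex) symmetrizable Kac-Moody algebra with Cartan subalgebra $\mathfrak h$, standard invariant bilinear form $(\cdot,\cdot)$, root spaces $\mathfrak g_\alpha$, real roots $\Delta^{\mathrm{re}}=\{\alpha\in\Delta:(\alpha,\alpha)>0\}$, and reflections $s_\alpha$, $\alpha\in\Delta^{\mathrm{re}}$. $\mathbb Z_+$ (resp. $\mathbb Z_-$) denotes the non-negative (resp. non-positive) integers. A real closed subroot system of $\Delta$ is a non-empty subset $\Psi\subseteq\Delta^{\mathrm{re}}$ such that $s_\alpha(\beta)\in\Psi$ for all $\alpha,\beta\in\Psi$, and such that $\alpha,\beta\in\Psi$, $\alpha+\beta\in\Delta^{\mathrm{re}}$ implies $\alpha+\beta\in\Psi$. A $\pi$-system of $\Delta$ is a subset $\Sigma\subseteq\Delta^{\mathrm{re}}$ with $\alpha-\beta\notin\Delta$ for all $\alpha,\beta\in\Sigma$. For a non-empty subset $\Psi\subseteq\Delta^{\mathrm{re}}$ with $s_\alpha(\beta)\in\Psi$ for all $\alpha,\beta\in\Psi$, let $\Omega=\Psi\cap\Delta^+$ and for $\gamma_1,\gamma_2\in\Omega$ write $\gamma_1\preceq\gamma_2$ iff $\gamma_2=a\gamma_1+\sum_{\tau\in\Omega\setminus\{\gamma_1,\gamma_2\}}a_\tau\tau$ for some $a\in\mathbb Q_{>0}$, $a_\tau\in\mathbb Q_{\ge0}$ (finitely many non-zero). Then $\Pi(\Psi)\subseteq\Psi\cap\Delta^+$ is the set of minimal elements, i.e. those $\gamma_2\in\Omega$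 such that $\gamma_1\in\Omega$, $\gamma_1\preceq\gamma_2$ implies $\gamma_1=\gamma_2$. Equivalently, $\Pi(\Psi)=\{\beta\in\Psi\cap\Delta^+: s_\beta((\Psi\cap\Delta^+)\setminus\{\beta\})=(\Psi\cap\Delta^+)\setminus\{\beta\}\}$. For $S\subseteq\Delta^{\mathrm{re}}$, $\mathfrak g(S)$ denotes the Lie subalgebra of $\mathfrak g$ generated by $\mathfrak g_\alpha$, $\alpha\in S\cup -S$. For an $\mathfrak h$-invariant subalgebra $\mathfrak s$, $\Delta(\mathfrak s)=\{\alpha\in\Delta:\mathfrak g_\alpha\cap\mathfrak s\ne0\}$ and $\Delta(\mathfrak s)^{\mathrm{re}}=\Delta(\mathfrak s)\cap\Delta^{\mathrm{re}}$.
   Formalization: In part (2) the formal statement additionally assumes that the π-system Σ consists of positive roots (Σ ⊆ Δ⁺); without this the claim fails, e.g. for sl₂ with Σ = {−α}. *)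

(* Defs.v *)
From HB Require Import structures.
From mathcomp Require Import all_boot all_order all_algebra.
From mathcomp Require Import complex.
From mathcomp Require Import boolp classical_sets reals.
Set Implicit Arguments.
Unset Strict Implicit.
Unset Printing Implicit Defensive.
Import Order.TTheory GRing.Theory Num.Theory.
Local Open Scope classical_set_scope.
Local Open Scope ring_scope.

HB.mixin Record Lmodule_isLieAlgebra (K : fieldType) L of GRing.Lmodule K L := {
  lie : L -> L -> L;
  lie_linear_l : forall (y : L) (a : K) (x x' : L),
    lie (a *: x + x') y = a *: lie x y + lie x' y;
  lie_linear_r : forall (x : L) (a : K) (y y' : L),
    lie x (a *: y + y') = a *: lie x y + lie x y';
  lie_alt : forall x : L, lie x x = 0;
  lie_jacobi : forall x y z : L,
    lie x (lie y z) + lie y (lie z x) + lie z (lie x y) = 0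
}.

#[short(type="lieAlgType")]
HB.structure Definition LieAlgebra (K : fieldType) :=
  { L of GRing.Lmodule K L & Lmodule_isLieAlgebra K L }.

Definition subspace (K : fieldType) (V : lmodType K) (S : set V) : Prop :=
  S 0 /\ forall (a : K) (x y : V), S x -> S y -> S (a *: x + y).

Definition lie_subalgebra (K : fieldType) (L : lieAlgType K) (S : set L) : Prop :=
  subspace S /\ forall x y : L, S x -> S y -> S (lie x y).

Definition lie_ideal (K : fieldType) (L : lieAlgType K) (I : set L) : Prop :=
  subspace I /\ forall x y : L, I y -> I (lie x y).

Definition lie_gen (K : fieldType) (L : lieAlgType K) (S : set L) : set L :=
  smallest (@lie_subalgebra K L) S.

Definition gcm (n : nat) (A : 'M[int]_n) : Prop :=
  [/\ forall i, A i i = 2,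
      forall i j, i != j -> A i j <= 0
    & forall i j, A i j = 0 -> A j i = 0].

(* A = diag(eps) B with B symmetric and eps positive; in a numClosedFieldType
   [0 < eps i] entails that [eps i] is real. *)
Definition symmetrization (K : numClosedFieldType) (n : nat) (A : 'M[int]_n)
    (eps : 'rV[K]_n) : Prop :=
  (forall i, 0 < eps 0 i) /\
  exists B : 'M[K]_n, B^T = B /\ map_mx intr A = diag_mx eps *m B.

Definition realization (K : fieldType) (n : nat) (A : 'M[int]_n) (h : vectType K)
    (alpha : 'I_n -> 'Hom(h, K^o)) (alphav : 'I_n -> h) : Prop :=
  [/\ free [seq alpha i | i : 'I_n],
      free [seq alphav i | i : 'I_n],
      forall i j, alpha j (alphav i) = (A i j)%:~R
    & (\dim {:h} = n.*2 - \rank (map_mx intr A : 'M[K]_n))%N].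

(* Restriction to h of the standard invariant form attached to eps and to a
   complement V of the span of the coroots; it is this restriction that
   induces the form on the dual of h. *)
Definition standard_form (K : fieldType) (n : nat) (h : vectType K)
    (alpha : 'I_n -> 'Hom(h, K^o)) (alphav : 'I_n -> h) (eps : 'rV[K]_n)
    (form : {bilinear h -> h -> K^o}) : Prop :=
  [/\ forall x y, form x y = form y x,
      forall i x, form (alphav i) x = eps 0 i * alpha i x
    & exists V : {vspace h},
        [/\ (<<[seq alphav i | i : 'I_n]>> + V = fullv)%VS,
            (<<[seq alphav i | i : 'I_n]>> :&: V = 0)%VS
          & {in V &, forall x y, form x y = 0}]].

(* g(A) is the quotient of the algebra presented by h, e_i, f_i and the
   Chevalley relations by its largest ideal meeting h trivially. *)
Record kac_moody_axioms (K : fieldType) (n : nat) (A : 'M[int]_n)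
    (h : vectType K) (alpha : 'I_n -> 'Hom(h, K^o)) (alphav : 'I_n -> h)
    (g : lieAlgType K) (iota : {linear h -> g}) (e f : 'I_n -> g) : Prop := {
  km_gcm : gcm A;
  km_realization : realization A alpha alphav;
  km_iota_inj : injective iota;
  km_hh : forall x y, lie (iota x) (iota y) = 0;
  km_he : forall x i, lie (iota x) (e i) = (alpha i x : K) *: e i;
  km_hf : forall x i, lie (iota x) (f i) = - (alpha i x : K) *: f i;
  km_ef : forall i j, lie (e i) (f j) = if i == j then iota (alphav i) else 0;
  km_gen : lie_gen (range iota `|` range e `|` range f) = setT;
  km_noideal : forall I : set g,
    lie_ideal I -> I `&` range iota `<=` [set 0] -> I = [set 0]
}.

Record symKacMoody (K : numClosedFieldType) := SymKacMoody {
  km_n : nat;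
  km_A : 'M[int]_km_n;
  cartan : vectType K;
  simple_root : 'I_km_n -> 'Hom(cartan, K^o);
  simple_coroot : 'I_km_n -> cartan;
  km_alg : lieAlgType K;
  cartan_inj : {linear cartan -> km_alg};
  chevalley_e : 'I_km_n -> km_alg;
  chevalley_f : 'I_km_n -> km_alg;
  km_eps : 'rV[K]_km_n;
  cartan_form : {bilinear cartan -> cartan -> K^o};
  km_axioms : kac_moody_axioms km_A simple_root simple_coroot cartan_inj
                chevalley_e chevalley_f;
  km_symmetrization : symmetrization km_A km_eps;
  km_standard : standard_form simple_root simple_coroot km_eps cartan_form
}.

(* The form on the dual of h transported along nu : h -> h^*, x |-> (x, .),
   which is bijective because a standard form is nondegenerate. *)
Definition form_nu (K : numClosedFieldType) (g : symKacMoody K) :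
    'Hom(cartan g, 'Hom(cartan g, K^o)) :=
  linfun (fun x => linfun (cartan_form g x)).

Definition dual_form (K : numClosedFieldType) (g : symKacMoody K)
    (lam mu : 'Hom(cartan g, K^o)) : K :=
  cartan_form g ((form_nu g)^-1%VF lam) ((form_nu g)^-1%VF mu).

Definition root_space (K : numClosedFieldType) (g : symKacMoody K)
    (lam : 'Hom(cartan g, K^o)) : set (km_alg g) :=
  [set x | forall t : cartan g, lie (cartan_inj g t) x = (lam t : K) *: x].

Definition roots (K : numClosedFieldType) (g : symKacMoody K) :
    set 'Hom(cartan g, K^o) :=
  [set lam | lam != 0 /\ exists2 x, root_space lam x & x != 0].
Arguments roots {K} g _.

Definition pos_roots (K : numClosedFieldType) (g : symKacMoody K) :
    set 'Hom(cartan g, K^o) :=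
  [set lam | roots g lam /\
     exists k : 'I_(km_n g) -> nat, lam = \sum_i simple_root i *+ k i].
Arguments pos_roots {K} g _.

Definition neg_roots (K : numClosedFieldType) (g : symKacMoody K) :
    set 'Hom(cartan g, K^o) :=
  [set lam | pos_roots g (- lam)].
Arguments neg_roots {K} g _.

Definition real_roots (K : numClosedFieldType) (g : symKacMoody K) :
    set 'Hom(cartan g, K^o) :=
  [set lam | roots g lam /\ 0 < dual_form lam lam].
Arguments real_roots {K} g _.

Definition reflection (K : numClosedFieldType) (g : symKacMoody K)
    (alpha beta : 'Hom(cartan g, K^o)) : 'Hom(cartan g, K^o) :=
  beta - (2 * dual_form beta alpha / dual_form alpha alpha) *: alpha.

Definition real_closed_subroot_system (K : numClosedFieldType)
    (g : symKacMoody K) (Psi : set 'Hom(cartan g, K^o)) : Prop :=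
  [/\ Psi !=set0,
      Psi `<=` real_roots g,
      forall alpha beta, Psi alpha -> Psi beta -> Psi (reflection alpha beta)
    & forall alpha beta, Psi alpha -> Psi beta ->
        real_roots g (alpha + beta) -> Psi (alpha + beta)].

Definition pi_system (K : numClosedFieldType) (g : symKacMoody K)
    (Sigma : set 'Hom(cartan g, K^o)) : Prop :=
  Sigma `<=` real_roots g /\
  forall alpha beta, Sigma alpha -> Sigma beta -> ~ roots g (alpha - beta).

Definition root_preceq (K : numClosedFieldType) (g : symKacMoody K)
    (Omega : set 'Hom(cartan g, K^o)) (gam1 gam2 : 'Hom(cartan g, K^o)) : Prop :=
  exists (a : rat) (s : seq 'Hom(cartan g, K^o)) (c : 'Hom(cartan g, K^o) -> rat),
    [/\ 0 < a,
        forall tau, tau \in s ->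
          [/\ Omega tau, tau != gam1, tau != gam2 & 0 <= c tau]
      & gam2 = ratr a *: gam1 + \sum_(tau <- s) ratr (c tau) *: tau].

Definition simple_system (K : numClosedFieldType) (g : symKacMoody K)
    (Psi : set 'Hom(cartan g, K^o)) : set 'Hom(cartan g, K^o) :=
  let Omega := Psi `&` pos_roots g in
  [set gam2 | Omega gam2 /\
     forall gam1, Omega gam1 -> root_preceq Omega gam1 gam2 -> gam1 = gam2].

Definition root_gen (K : numClosedFieldType) (g : symKacMoody K)
    (S : set 'Hom(cartan g, K^o)) : set (km_alg g) :=
  lie_gen (\bigcup_(alpha in S `|` [set - beta | beta in S]) root_space alpha).

Definition roots_of (K : numClosedFieldType) (g : symKacMoody K)
    (s : set (km_alg g)) : set 'Hom(cartan g, K^o) :=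
  [set alpha | roots g alpha /\ ~ (root_space alpha `&` s `<=` [set 0])].

Definition Zplus_span (V : zmodType) (S : set V) : set V :=
  [set lam | exists (s : seq V) (k : V -> nat),
     (forall sigma, sigma \in s -> S sigma) /\
     lam = \sum_(sigma <- s) sigma *+ k sigma].

Definition Zminus_span (V : zmodType) (S : set V) : set V :=
  [set lam | exists (s : seq V) (k : V -> nat),
     (forall sigma, sigma \in s -> S sigma) /\
     lam = \sum_(sigma <- s) sigma *- k sigma].

(* Main.v *)
Require Import Defs.
From HB Require Import structures.
From mathcomp Require Import all_boot all_order all_algebra.
From mathcomp Require Import complex ring zify.
From mathcomp Require Import boolp classical_sets reals.
Set Implicit Arguments.
Unset Strict Implicit.
Unset Printing Implicit Defensive.
Import Order.TTheory GRing.Theory Num.Theory.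
Local Open Scope classical_set_scope.
Local Open Scope ring_scope.

(* Exponentials of the locally nilpotent ad e_i and ad f_i (Serre relations) give
   automorphisms of g inducing the reflections s_i; descent on the height shows
   that a root of positive norm is a Weyl translate of a simple root, so every
   real root tau carries an sl2-triple in g_tau, g_{-tau} and an automorphism,
   built from that triple, which realizes s_tau.

   (1) If gamma in Psi+ is not minimal, some tau in Psi+ satisfies
   0 < s_tau(gamma) = gamma - p tau with p > 0. Then tau and s_tau(gamma) are
   lower, and g_gamma lies in the algebra generated by g_{+-tau} and
   g_{s_tau(gamma)}.

   (2) As [g_alpha, g_{-beta}] = 0 for distinct alpha, beta in Sigma, g(Sigma) is
   contained in n_Sigma^- + g_0 + n_Sigma^+, where n_Sigma^{+-} is generated by
   the g_{+-alpha}; compare weights.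

   (3) Pi(Psi) is a pi-system: if alpha - beta is a root, its norm is positive
   because (alpha, beta) <= 0, so it lies in Psi, contradicting minimality. Then
   a positive real root lambda of g(Psi) = g(Pi(Psi)) is a sum of elements of
   Pi(Psi), pairs positively with one of them, alpha, and s_alpha(lambda) is a
   lower root of g(Psi), unless lambda = alpha. *)

(** [Psi] may be infinite. The finite object that makes the descent in (1) work is the set of
    positive roots that a single reflection makes negative. Minimality in Pi(Psi) is defined by
    rational relations, and all the combinatorics passes through two translations of it. A root
    gamma such that s_gamma keeps the other positive roots of Psi positive is minimal, because the
    height composed with s_gamma is negative on gamma alone. Conversely, no multiple of a minimal
    root is a sum of positive roots of Psi that involves a different one: cancelling and dividing
    would give a forbidden relation. The scalars are only partially ordered, so the alternative
    between (lambda, tau) > 0 and (lambda, tau) <= 0 is not free. It comes from the integrality of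
    lambda on the coroot of tau, which is proved by moving tau to a simple root. The Serre relations
    are not among the axioms. They are derived from the absence of ideals meeting the Cartan
    subalgebra trivially. *)

(** * Lie algebra calculus, generated subalgebras, triangular decompositions *)

Section LieBasics.
Variables (K : fieldType) (L : lieAlgType K).
Implicit Types (x y z : L) (S G E F H : set L).

Lemma lieDl x y z : lie (x + y) z = lie x z + lie y z.
Proof. by have := lie_linear_l z 1 x y; rewrite !scale1r. Qed.

Lemma lieDr x y z : lie x (y + z) = lie x y + lie x z.
Proof. by have := lie_linear_r x 1 y z; rewrite !scale1r. Qed.

Lemma lie0l y : lie 0 y = 0.
Proof. by apply: (addrI (lie 0 y)); rewrite -lieDl !addr0. Qed.

Lemma lie0r y : lie y 0 = 0.
Proof. by apply: (addrI (lie y 0)); rewrite -lieDr !addr0. Qed.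

Lemma lieZl a x y : lie (a *: x) y = a *: lie x y.
Proof. by have := lie_linear_l y a x 0; rewrite !addr0 lie0l addr0. Qed.

Lemma lieZr a x y : lie x (a *: y) = a *: lie x y.
Proof. by have := lie_linear_r x a y 0; rewrite !addr0 lie0r addr0. Qed.

Lemma lieNl x y : lie (- x) y = - lie x y.
Proof. by rewrite -scaleN1r lieZl scaleN1r. Qed.

Lemma lieNr x y : lie x (- y) = - lie x y.
Proof. by rewrite -scaleN1r lieZr scaleN1r. Qed.

Lemma lieC x y : lie x y = - lie y x.
Proof.
apply/eqP; rewrite -addr_eq0; apply/eqP.
have := lie_alt (x + y).
by rewrite lieDl !lieDr !lie_alt add0r addr0.
Qed.

Lemma lie_der x y z : lie x (lie y z) = lie (lie x y) z + lie y (lie x z).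
Proof.
have := lie_jacobi x y z.
rewrite [lie y (lie z x)]lieC [lie z (lie x y)]lieC [lie z x]lieC lieNl opprK.
rewrite [lie (lie x z) y]lieC => /eqP; rewrite subr_eq0 => /eqP <-.
by rewrite addrNK.
Qed.

Lemma lie_sumr (I : Type) (s : seq I) (P : pred I) (F0 : I -> L) x :
  lie x (\sum_(i <- s | P i) F0 i) = \sum_(i <- s | P i) lie x (F0 i).
Proof. exact: (big_morph (lie x) (lieDr x) (lie0r x)). Qed.

Lemma subspace0 S : subspace S -> S 0.
Proof. by case. Qed.

Lemma subspaceP S a x y : subspace S -> S x -> S y -> S (a *: x + y).
Proof. by case=> _ hS; apply: hS. Qed.

Lemma subspaceD S x y : subspace S -> S x -> S y -> S (x + y).
Proof. by case=> _ h Sx Sy; rewrite -[x]scale1r; apply: h. Qed.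

Lemma subspaceZ S a x : subspace S -> S x -> S (a *: x).
Proof. by case=> h0 h Sx; rewrite -[_ *: _]addr0; apply: h. Qed.

Lemma subspaceN S x : subspace S -> S x -> S (- x).
Proof. by move=> hS Sx; rewrite -scaleN1r; apply: subspaceZ. Qed.

Lemma subspace_sum S (I : Type) (s : seq I) (P : pred I) (F0 : I -> L) :
  subspace S -> (forall i, P i -> S (F0 i)) -> S (\sum_(i <- s | P i) F0 i).
Proof.
by move=> hS h; apply: (big_ind S) => //; [apply: subspace0|move=> *; apply: subspaceD].
Qed.

Lemma sub_lie_gen G : G `<=` lie_gen G.
Proof. exact: sub_smallest. Qed.

Lemma lie_gen_min G S : lie_subalgebra S -> G `<=` S -> lie_gen G `<=` S.
Proof. by move=> hS hG; apply: smallest_sub. Qed.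

Lemma lie_gen_subalg G : lie_subalgebra (lie_gen G).
Proof.
split; first split.
- by move=> S [[[]]].
- move=> a x y hx hy S hS; case: (hS) => [[[_ h] _] _].
  by apply: h; [apply: hx|apply: hy].
move=> x y hx hy S hS; case: (hS) => [[_ h] _].
by apply: h; [apply: hx|apply: hy].
Qed.

Lemma lie_gen_subspace G : subspace (lie_gen G).
Proof. by case: (lie_gen_subalg G). Qed.

Lemma lie_genL G x y : lie_gen G x -> lie_gen G y -> lie_gen G (lie x y).
Proof. by case: (lie_gen_subalg G) => _; apply. Qed.

(** By the Jacobi identity the elements of [S] whose ad preserves [S] form a subalgebra, so only
    brackets with generators have to be controlled. *)
Lemma lie_gen_ad G S : subspace S -> G `<=` S ->
  (forall x y, G x -> S y -> S (lie x y)) -> lie_gen G `<=` S.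
Proof.
move=> hS GS GadS.
suff: lie_gen G `<=` [set x | S x /\ forall y, S y -> S (lie x y)].
  by move=> h x /h [].
apply: lie_gen_min; last by move=> x Gx; split; [apply: GS|move=> y; apply: GadS].
split; first split.
- by split; [apply: subspace0|move=> y _; rewrite lie0l; apply: subspace0].
- move=> a x y [Sx hx] [Sy hy]; split; first by apply: subspaceP.
  by move=> z Sz; rewrite lieDl lieZl; apply: subspaceP => //; [apply: hx|apply: hy].
move=> x y [Sx hx] [Sy hy]; split; first exact: hx.
move=> z Sz; have -> : lie (lie x y) z = lie x (lie y z) - lie y (lie x z).
  by rewrite lie_der addrK.
apply: subspaceD => //; first exact: (hx _ (hy _ Sz)).
by apply: subspaceN => //; exact: (hy _ (hx _ Sz)).
Qed.

Lemma lie_gen_der G t : (forall x, G x -> lie_gen G (lie t x)) ->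
  forall x, lie_gen G x -> lie_gen G (lie t x).
Proof.
move=> hG x hx.
suff: lie_gen G `<=` [set x | lie_gen G x /\ lie_gen G (lie t x)].
  by move=> /(_ _ hx) [].
have hS := lie_gen_subspace G.
apply: lie_gen_min; last by move=> y Gy; split; [apply: sub_lie_gen|apply: hG].
split; first split.
- by split; [|rewrite lie0r]; apply: subspace0.
- move=> a y z [h1 h2] [h3 h4]; rewrite /= lieDr lieZr.
  by split; apply: (subspaceP _ hS).
move=> y z [h1 h2] [h3 h4]; split; first exact: lie_genL.
by rewrite lie_der; apply: (subspaceD hS); apply: lie_genL.
Qed.

Lemma lie_gen_cross E F H : subspace H ->
  (forall x y, E x -> F y -> H (lie x y)) ->
  (forall x y, H x -> F y -> lie_gen F (lie x y)) ->
  forall x y, E x -> lie_gen F y ->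
    exists a b, [/\ lie_gen F a, H b & lie x y = a + b].
Proof.
move=> hH EF HF x y Ex Fy.
have hS := lie_gen_subspace F.
suff: lie_gen F `<=` [set y | lie_gen F y /\
    exists a b, [/\ lie_gen F a, H b & lie x y = a + b]].
  by move=> /(_ _ Fy) [].
apply: lie_gen_min; last first.
  move=> z Fz; split; first exact: sub_lie_gen.
  exists 0, (lie x z); split; [exact: subspace0|exact: EF|by rewrite add0r].
split; first split.
- split; first exact: subspace0.
  by exists 0, 0; split; [exact: subspace0|exact: subspace0|rewrite lie0r addr0].
- move=> c z z' [h1 [a [b [ha hb e1]]]] [h1' [a' [b' [ha' hb' e1']]]].
  split; first by apply: (subspaceP _ hS).
  exists (c *: a + a'), (c *: b + b'); split; [exact: (subspaceP _ hS)|exact: (subspaceP _ hH)|].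
  by rewrite lieDr lieZr e1 e1' scalerDr addrACA.
move=> z z' [h1 [a [b [ha hb e1]]]] [h1' [a' [b' [ha' hb' e1']]]].
split; first exact: lie_genL.
have HF' t w : H t -> lie_gen F w -> lie_gen F (lie t w).
  by move=> Ht; apply: lie_gen_der => u; apply: HF.
(* On brackets the [H] component vanishes: [H] normalizes the algebra generated by [F], so both
   Leibniz terms land in that algebra. *)
exists (lie x (lie z z')), 0; split; [|exact: subspace0|by rewrite addr0].
rewrite lie_der e1 e1' lieDl lieDr; apply: (subspaceD hS); apply: (subspaceD hS).
- exact: lie_genL.
- exact: HF'.
- exact: lie_genL.
- by rewrite lieC; apply: (subspaceN hS); apply: HF'.
Qed.

(** Applied twice: to the whole algebra, with [H] the Cartan subalgebra, and to g(Sigma), with [H]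
    the weight space of 0. *)
Lemma lie_gen_triangular E F H : subspace H ->
  (forall x y, H x -> H y -> H (lie x y)) ->
  (forall x y, E x -> F y -> H (lie x y)) ->
  (forall x y, H x -> E y -> lie_gen E (lie x y)) ->
  (forall x y, H x -> F y -> lie_gen F (lie x y)) ->
  lie_gen (H `|` E `|` F) `<=` [set x | exists a b c,
    [/\ lie_gen F a, H b, lie_gen E c & x = a + b + c]].
Proof.
move=> hH HH EF HE HF.
have hSE := lie_gen_subspace E; have hSF := lie_gen_subspace F.
have FE x y : F x -> E y -> H (lie x y).
  by move=> Fx Ey; rewrite lieC; apply: subspaceN => //; apply: EF.
have HE' x y : H x -> lie_gen E y -> lie_gen E (lie x y).
  by move=> Hx; apply: lie_gen_der => u; apply: HE.
have HF' x y : H x -> lie_gen F y -> lie_gen F (lie x y).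
  by move=> Hx; apply: lie_gen_der => u; apply: HF.
apply: lie_gen_ad.
- split; first by exists 0, 0, 0; rewrite !addr0; split => //; apply: subspace0.
  move=> k x y [a [b [c [ha hb hc ->]]]] [a' [b' [c' [ha' hb' hc' ->]]]].
  exists (k *: a + a'), (k *: b + b'), (k *: c + c'); split;
    [exact: (subspaceP _ hSF)|exact: (subspaceP _ hH)|exact: (subspaceP _ hSE)|].
  by rewrite !scalerDr addrACA (addrACA (k *: a)).
- move=> x [[Hx|Ex]|Fx].
  + by exists 0, x, 0; rewrite addr0 add0r; split => //; apply: subspace0.
  + exists 0, 0, x; rewrite !add0r; split => //; [exact: subspace0|exact: subspace0|].
    exact: sub_lie_gen.
  + exists x, 0, 0; rewrite !addr0; split => //; [|exact: subspace0|exact: subspace0].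
    exact: sub_lie_gen.
move=> x _ Gx [a [b [c [ha hb hc ->]]]]; rewrite !lieDr.
case: Gx => [[Hx|Ex]|Fx].
- exists (lie x a), (lie x b), (lie x c); split => //; [exact: HF'|exact: HH|exact: HE'].
- have [a1 [b1 [ha1 hb1 ->]]] := lie_gen_cross hH EF HF Ex ha.
  exists a1, b1, (lie x b + lie x c); split; rewrite ?addrA //.
  apply: (subspaceD hSE); last by apply: lie_genL => //; apply: sub_lie_gen.
  by rewrite lieC; apply: (subspaceN hSE); apply: HE.
- have [c1 [b1 [hc1 hb1 ->]]] := lie_gen_cross hH FE HE Fx hc.
  exists (lie x a + lie x b), b1, c1; split; rewrite ?(addrC c1) ?addrA //.
  apply: (subspaceD hSF); first by apply: lie_genL => //; apply: sub_lie_gen.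
  by rewrite lieC; apply: (subspaceN hSF); apply: HF.
Qed.

End LieBasics.

(** * Weight spaces and independence of distinct weights *)

Section Weights.
Variables (K : fieldType) (L : lieAlgType K) (h : vectType K).
Variable iota : {linear h -> L}.
Hypothesis iota_comm : forall x y, lie (iota x) (iota y) = 0.
Implicit Types (lam mu : 'Hom(h, K^o)) (P : set 'Hom(h, K^o)) (x y : L).

Definition wsp lam : set L :=
  [set x | forall t : h, lie (iota t) x = (lam t : K) *: x].

Lemma wsp_subspace lam : subspace (wsp lam).
Proof.
split; first by move=> t; rewrite lie0r scaler0.
by move=> a x y hx hy t; rewrite lieDr lieZr hx hy scalerDr !scalerA mulrC.
Qed.

Lemma wspL lam mu x y : wsp lam x -> wsp mu y -> wsp (lam + mu) (lie x y).
Proof.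
move=> hx hy t; rewrite lie_der hx hy lieZl lieZr lfunE /= -scalerDl.
by [].
Qed.

Lemma wsp_iota t : wsp 0 (iota t).
Proof. by move=> u; rewrite iota_comm lfunE /= scale0r. Qed.

Definition wsum P : set L := [set x | exists s : seq ('Hom(h, K^o) * L),
  (forall p, p \in s -> P p.1 /\ wsp p.1 p.2) /\ x = \sum_(p <- s) p.2].

Lemma wsum_sub P mu x : P mu -> wsp mu x -> wsum P x.
Proof.
move=> Pm hx; exists [:: (mu, x)]; split; last by rewrite big_seq1.
by move=> p; rewrite inE => /eqP ->.
Qed.

Lemma wsum_subspace P : subspace (wsum P).
Proof.
split; first by exists [::]; rewrite big_nil.
move=> a x y [s [hs ->]] [s' [hs' ->]].
exists ([seq (p.1, a *: p.2) | p <- s] ++ s'); split; last first.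
  by rewrite big_cat big_map scaler_sumr.
move=> p; rewrite mem_cat => /orP [/mapP [q /hs [h1 h2] ->]|/hs' //].
by split => //; exact: (subspaceZ _ (wsp_subspace _)).
Qed.

Lemma wsum_ind P (S : set L) : subspace S ->
  (forall mu x, P mu -> wsp mu x -> S x) -> wsum P `<=` S.
Proof.
move=> hS hP x [s [hs ->]]; rewrite big_seq_cond.
by apply: subspace_sum => // p; rewrite andbT => /hs [h1 h2]; apply: hP h1 h2.
Qed.

Lemma wsum_mono P P' : P `<=` P' -> wsum P `<=` wsum P'.
Proof.
by move=> hP; apply: wsum_ind; [apply: wsum_subspace|move=> mu x /hP; apply: wsum_sub].
Qed.

Lemma wsumL P P' P'' x y : (forall lam mu, P lam -> P' mu -> P'' (lam + mu)) ->
  wsum P x -> wsum P' y -> wsum P'' (lie x y).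
Proof.
move=> hP hx hy; have hS := wsum_subspace P''.
apply: (wsum_ind (S := [set z | wsum P'' (lie z y)])) hx.
  split; first by rewrite /= lie0l; apply: subspace0.
  by move=> a u v hu hv; rewrite /= lieDl lieZl; apply: subspaceP.
move=> mu u Pm hu.
apply: (wsum_ind (S := [set z | wsum P'' (lie u z)])) hy.
  split; first by rewrite /= lie0r; apply: subspace0.
  by move=> a w v hw hv; rewrite /= lieDr lieZr; apply: subspaceP.
move=> nu v Pn hv; apply: (@wsum_sub _ (mu + nu)); [exact: hP|exact: wspL].
Qed.

(** Induction on the number of summands. For [t] separating [lam] from the first weight [mu], the
    operator ad t - mu(t) kills the first summand, rescales the others, and multiplies the whole sum
    by lam(t) - mu(t), which is nonzero. *)
Lemma wsum_indep P lam x : wsum P x -> wsp lam x -> ~ P lam -> x = 0.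
Proof.
move=> [s [hs ->]] hx hl; have [n sn] := ubnP (size s).
elim: n s sn hs hx => // n IH [|[mu y] s] sn hs hx; first by rewrite big_nil.
have nml : mu != lam.
  by apply/eqP => e; apply: hl; rewrite -e; case: (hs (mu, y)) => //; rewrite mem_head.
have [t ht] : exists t, mu t != lam t.
  apply: contrapT => /forallNP H; case/eqP: nml; apply/lfunP => t.
  by have := H t => /negP; rewrite negbK => /eqP.
have wy : wsp mu y by case: (hs (mu, y)); rewrite ?mem_head.
have nz : (lam t : K) - mu t != 0 by rewrite subr_eq0 eq_sym.
set s' := [seq (p.1, ((p.1 t : K) - mu t) *: p.2) | p : 'Hom(h, K^o) * L <- s].
have e2 : \sum_(p <- s') p.2 = ((lam t : K) - mu t) *: \sum_(p <- (mu, y) :: s) p.2.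
  rewrite scalerBl -hx lie_sumr scaler_sumr -sumrB big_cons /= wy subrr add0r.
  rewrite big_map big_seq [RHS]big_seq; apply: eq_bigr => p ps.
  by case: (hs p); rewrite ?inE ?ps ?orbT // => _ ->; rewrite scalerBl.
have : \sum_(p <- s') p.2 = 0.
  apply: IH; first by rewrite size_map.
    move=> p /mapP [q qs ->]; case: (hs q); rewrite ?inE ?qs ?orbT // => h1 h2.
    by split => //; exact: (subspaceZ _ (wsp_subspace _)).
  by rewrite e2; exact: (subspaceZ _ (wsp_subspace _)).
by rewrite e2 => /eqP; rewrite scaler_eq0 (negbTE nz) /= => /eqP.
Qed.

End Weights.

(** * Exponentials of locally nilpotent ad x *)

(** Cauchy product: the 2N antidiagonals cover the square outside which [a] vanishes. It serves both
    for the multiplicativity of exp and for exp(-x) exp(x) = 1. *)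
Lemma sum_square_diag (V : zmodType) (a : nat -> nat -> V) N :
  (forall i j, (N <= i)%N || (N <= j)%N -> a i j = 0) ->
  \sum_(i < N) \sum_(j < N) a i j =
  \sum_(n < N + N) \sum_(k < n.+1) a k (n - k)%N.
Proof.
move=> a0.
transitivity (\sum_(n < N + N) \sum_(k < N + N | (k <= n)%N) a k (n - k)%N); last first.
  apply: eq_bigr => n _.
  by rewrite (big_ord_widen_cond (N + N) xpredT (fun k => a k (n - k)%N)).
rewrite [RHS](exchange_big_dep xpredT) //= [RHS]big_split_ord /= [X in _ = _ + X]big1 ?addr0; last first.
  by move=> k _; apply: big1 => n _; apply: a0; rewrite leq_addr.
apply: eq_bigr => k _.
rewrite -(big_mkord (fun n => (k <= n)%N) (fun n => a k (n - k)%N)).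
have kN : (k <= N + N)%N by apply: leq_trans (ltnW (ltn_ord k)) (leq_addr _ _).
rewrite (big_cat_nat (n := k)) //= [X in X + _]big_nat_cond [X in X + _]big1 ?add0r; last first.
  by move=> n /andP [/andP [_ nk] kn]; move: nk; rewrite ltnNge kn.
rewrite (big_addn 0 _ k) -addnBA ?(ltnW (ltn_ord k)) // big_mkord big_split_ord /=.
rewrite [X in _ = _ + X]big1 ?addr0; last first.
  by move=> n _; rewrite addnK; apply: a0; rewrite leq_addr orbT.
have -> : \sum_(j < N | (k <= j + k)%N) a k (j + k - k)%N = \sum_(j < N) a k j.
  by apply: eq_big => // i; rewrite ?leq_addl ?addnK.
by [].
Qed.

Section Exp.
Variables (K : numFieldType) (L : lieAlgType K).
Implicit Types (x y z : L).

Definition ad_nilp x := forall y, exists N, iter N (lie x) y = 0.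

Definition dpow x n y : L := n`!%:R^-1 *: iter n (lie x) y.

Lemma iter_lieD x n y z : iter n (lie x) (y + z) = iter n (lie x) y + iter n (lie x) z.
Proof. by elim: n => //= n ->; rewrite lieDr. Qed.

Lemma iter_lieZ x n a y : iter n (lie x) (a *: y) = a *: iter n (lie x) y.
Proof. by elim: n => //= n ->; rewrite lieZr. Qed.

Lemma iter_lie0 x n : iter n (lie x) 0 = 0.
Proof. by elim: n => //= n ->; rewrite lie0r. Qed.

Lemma iter_lie_ge x n N y : (N <= n)%N -> iter N (lie x) y = 0 -> iter n (lie x) y = 0.
Proof. by move=> /subnK <- e; rewrite iterD e iter_lie0. Qed.

Lemma dpow0 x y : dpow x 0 y = y.
Proof. by rewrite /dpow fact0 invr1 scale1r. Qed.

Lemma dpow1 x y : dpow x 1 y = lie x y.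
Proof. by rewrite /dpow invr1 scale1r. Qed.

Lemma dpowD x n y z : dpow x n (y + z) = dpow x n y + dpow x n z.
Proof. by rewrite /dpow iter_lieD scalerDr. Qed.

Lemma dpowZ x n a y : dpow x n (a *: y) = a *: dpow x n y.
Proof. by rewrite /dpow iter_lieZ !scalerA mulrC. Qed.

Lemma dpow_0 x n : dpow x n 0 = 0.
Proof. by rewrite /dpow iter_lie0 scaler0. Qed.

Lemma dpow_sum x n (I : Type) (s : seq I) P (F : I -> L) :
  dpow x n (\sum_(i <- s | P i) F i) = \sum_(i <- s | P i) dpow x n (F i).
Proof. exact: (big_morph _ (dpowD x n) (dpow_0 x n)). Qed.

Lemma dpowS x n y : n.+1%:R *: dpow x n.+1 y = lie x (dpow x n y).
Proof.
rewrite /dpow lieZr /= scalerA factS natrM invfM mulrA divff ?mul1r //.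
by rewrite pnatr_eq0.
Qed.

Lemma dpowSr x n y : n.+1%:R *: dpow x n.+1 y = dpow x n (lie x y).
Proof. by rewrite dpowS /dpow lieZr -iterS iterSr. Qed.

Lemma dpow_der x n y z :
  dpow x n (lie y z) = \sum_(k < n.+1) lie (dpow x k y) (dpow x (n - k) z).
Proof.
elim: n => [|n IH]; first by rewrite big_ord_recl big_ord0 !dpow0 addr0.
have nz : n.+1%:R != 0 :> K by rewrite pnatr_eq0.
apply: (scalerI nz); rewrite dpowS IH lie_sumr.
under eq_bigr => k _ do rewrite lie_der -!dpowS.
rewrite big_split /=.
(* Splitting n+1 = k + (n+1-k): the first part collects ad x acting on [y], with a shift of index,
   the second ad x acting on [z]. *)
transitivity (\sum_(k < n.+2) (k%:R *: lie (dpow x k y) (dpow x (n.+1 - k) z)) +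
  \sum_(k < n.+2) ((n.+1 - k)%:R *: lie (dpow x k y) (dpow x (n.+1 - k) z))).
  congr (_ + _).
    rewrite [RHS]big_ord_recl /= mulr0n scale0r add0r; apply: eq_bigr => k _.
    by rewrite -lieZl.
  rewrite [RHS]big_ord_recr /= subnn mulr0n scale0r addr0; apply: eq_bigr => k _.
  by rewrite lieZr subSn // -ltnS.
rewrite -big_split scaler_sumr /=; apply: eq_bigr => k _.
by rewrite -scalerDl -natrD subnKC // -ltnS.
Qed.

(** The part of degree n+1 of exp(-x) exp(x) = 1. After multiplication by n+1 = k + (n+1-k), the
    first part of term k+1 cancels the second part of term k. *)
Lemma dpow_inv x n y :
  \sum_(k < n.+2) dpow (- x) k (dpow x (n.+1 - k) y) = 0.
Proof.
have nz : n.+1%:R != 0 :> K by rewrite pnatr_eq0.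
apply: (scalerI nz); rewrite scaler0 scaler_sumr.
transitivity (\sum_(k < n.+2) (k%:R *: dpow (- x) k (dpow x (n.+1 - k) y)) +
  \sum_(k < n.+2) ((n.+1 - k)%:R *: dpow (- x) k (dpow x (n.+1 - k) y))).
  rewrite -big_split /=; apply: eq_bigr => k _.
  by rewrite -scalerDl -natrD subnKC // -ltnS.
rewrite big_ord_recl /= mulr0n scale0r add0r [X in _ + X]big_ord_recr /= subnn mulr0n scale0r addr0.
rewrite -big_split /=; apply: big1 => k _.
have kn : (k <= n)%N by rewrite -ltnS.
rewrite /bump /= add1n subSS subSn //; set y' := dpow x (n - k) y.
rewrite dpowSr -dpowZ dpowS -/y' lieNl.
have -> : dpow (- x) k (- lie x y') = - dpow (- x) k (lie x y').
  by rewrite -[- lie x y']scaleN1r dpowZ scaleN1r.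
exact: addNr.
Qed.

(** The series is cut at some order where it has vanished, picked by [xget]; [expadE] shows that the
    choice does not matter. If no iterate kills [y], the default 0 makes the sum empty. *)
Definition expad x y : L :=
  \sum_(k < xget 0%N [set N | iter N (lie x) y = 0]) dpow x k y.

Lemma expadE x y N : iter N (lie x) y = 0 -> expad x y = \sum_(k < N) dpow x k y.
Proof.
move=> eN; rewrite /expad; case: xgetP => [M _ eM|/(_ N) //].
have sub m m' : iter m (lie x) y = 0 -> (m <= m')%N ->
    \sum_(k < m') dpow x k y = \sum_(k < m) dpow x k y.
  move=> em /subnKC <-; rewrite big_split_ord /= [X in _ + X]big1 ?addr0 // => i _.
  by rewrite /dpow (@iter_lie_ge _ _ m) ?scaler0 // leq_addr.
by have [mn|/ltnW mn] := leqP M N; [rewrite (sub M N)|rewrite (sub N M)].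
Qed.

Lemma ad_nilpN x : ad_nilp x -> ad_nilp (- x).
Proof.
move=> nx y; have [N e] := nx y; exists N.
suff -> : iter N (lie (- x)) y = (-1) ^+ N *: iter N (lie x) y by rewrite e scaler0.
elim: {e} N => [|N /= ->]; first by rewrite scale1r.
by rewrite lieNl lieZr exprS mulN1r scaleNr.
Qed.

Section Nilp.
Variable x : L.
Hypothesis nx : ad_nilp x.

Lemma ad_nilp2 y z : exists N, iter N (lie x) y = 0 /\ iter N (lie x) z = 0.
Proof.
have [N e] := nx y; have [N' e'] := nx z; exists (maxn N N').
by rewrite (iter_lie_ge _ e) ?leq_maxl // (iter_lie_ge _ e') ?leq_maxr.
Qed.

Lemma expadD y z : expad x (y + z) = expad x y + expad x z.
Proof.
have [N [e e']] := ad_nilp2 y z.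
rewrite !(expadE (N := N)) ?iter_lieD ?e ?e' ?addr0 // -big_split /=.
by apply: eq_bigr => k _; rewrite dpowD.
Qed.

Lemma expadZ a y : expad x (a *: y) = a *: expad x y.
Proof.
have [N e] := nx y.
rewrite !(expadE (N := N)) ?iter_lieZ ?e ?scaler0 // scaler_sumr.
by apply: eq_bigr => k _; rewrite dpowZ.
Qed.

Lemma iter_lieL0 N y z n : iter N (lie x) y = 0 -> iter N (lie x) z = 0 ->
  (N + N <= n)%N -> iter n (lie x) (lie y z) = 0.
Proof.
move=> e e' Nn.
have : dpow x n (lie y z) = 0.
  rewrite dpow_der big1 // => k _.
  have [Nk|kN] := leqP N k; first by rewrite /dpow (iter_lie_ge Nk e) scaler0 lie0l.
  have Nnk : (N <= n - k)%N.
    by apply: leq_trans (leq_sub2r k Nn); rewrite -addnBA ?leq_addr // ltnW.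
  by rewrite [dpow x (n - k) z]/dpow (iter_lie_ge Nnk e') scaler0 lie0r.
move/eqP; rewrite scaler_eq0 invr_eq0 pnatr_eq0 -leqn0 leqNgt fact_gt0 /=.
by move/eqP.
Qed.

Lemma expadL y z : expad x (lie y z) = lie (expad x y) (expad x z).
Proof.
have [N [e e']] := ad_nilp2 y z.
rewrite (expadE (N := N + N)); last exact: (iter_lieL0 e e').
rewrite (expadE e) (expadE e').
under eq_bigr => n _ do rewrite dpow_der.
rewrite -(@sum_square_diag _ (fun i j => lie (dpow x i y) (dpow x j z))); last first.
  move=> i j /orP [] h; first by rewrite /dpow (iter_lie_ge h e) scaler0 lie0l.
  by rewrite [dpow x j z]/dpow (iter_lie_ge h e') scaler0 lie0r.
rewrite lieC lie_sumr -sumrN; apply: eq_bigr => i _.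
by rewrite -lieC lie_sumr.
Qed.

Lemma expadNK y : expad (- x) (expad x y) = y.
Proof.
have [N e] := nx y.
have eN n k : (N <= n)%N -> iter n (lie (- x)) (dpow x k y) = 0.
  move=> Nn; apply: (iter_lie_ge Nn).
  have -> : iter N (lie (- x)) (dpow x k y) = (-1) ^+ N *: iter N (lie x) (dpow x k y).
    elim: {e Nn} N => [|m /= ->]; first by rewrite scale1r.
    by rewrite lieNl lieZr exprS mulN1r scaleNr.
  by rewrite /dpow iter_lieZ -iterD addnC iterD e iter_lie0 !scaler0.
(* Order N+1 instead of N, so that the antidiagonal n = 0, which contributes [y], is present even
   when N = 0. *)
have Ne : iter N.+1 (lie x) y = 0 by apply: iter_lie_ge e.
rewrite (expadE Ne) (expadE (N := N.+1)); last first.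
  elim/big_ind: _ => [|a b ea eb|k _]; [exact: iter_lie0|by rewrite iter_lieD ea eb addr0|].
  exact: eN.
under eq_bigr => i _ do rewrite dpow_sum.
rewrite (@sum_square_diag _ (fun i j => dpow (- x) i (dpow x j y))); last first.
  move=> i j /orP [] h; first by rewrite {1}/dpow eN ?scaler0 // ltnW.
  by rewrite [dpow x j y]/dpow (iter_lie_ge _ Ne) ?scaler0 ?dpow_0.
rewrite addSn big_ord_recl [X in _ + X]big1 ?addr0; last first.
  by move=> n _; rewrite lift0; apply: dpow_inv.
by rewrite big_ord_recl big_ord0 addr0 !dpow0.
Qed.

Lemma expad_stable (S : set L) : subspace S -> (forall y, S y -> S (lie x y)) ->
  forall y, S y -> S (expad x y).
Proof.
move=> hS hx y Sy; apply: (subspace_sum _ hS) => k _; apply: (subspaceZ _ hS).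
by elim: (nat_of_ord k) => //= n IH; apply: hx.
Qed.

End Nilp.

Lemma expad_iter2 x y : iter 2 (lie x) y = 0 -> expad x y = y + lie x y.
Proof. by move=> /expadE ->; rewrite !big_ord_recl big_ord0 addr0 dpow0 dpow1. Qed.

Lemma expad_iter3 x y : iter 3 (lie x) y = 0 ->
  expad x y = y + lie x y + 2^-1 *: lie x (lie x y).
Proof.
move=> /expadE ->; rewrite !big_ord_recl big_ord0 addr0 dpow0 dpow1 addrA.
by congr (_ + _); rewrite /dpow /= /bump /=.
Qed.

End Exp.

(** * The automorphism attached to an sl2-triple, and its action on weights *)

Section ReflectionAutomorphism.
Variables (K : numFieldType) (L : lieAlgType K) (h : vectType K).
Variable iota : {linear h -> L}.
Hypothesis iota_comm : forall x y, lie (iota x) (iota y) = 0.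
Local Notation wsp := (wsp iota).
Implicit Types (lam mu tau : 'Hom(h, K^o)) (x y : L).

(** The relations [h, e] = 2e and [h, f] = -2f are contained in the weights of [e] and [f] together
    with [tau hh = 2]. *)
Definition root_triple tau (hh : h) e f :=
  [/\ wsp tau e, wsp (- tau) f, lie e f = iota hh & tau hh = 2] /\
  (ad_nilp e /\ ad_nilp f).

(** The triple with opposite signs yields the inverse of the automorphism. *)
Lemma root_tripleN tau hh e f : root_triple tau hh e f -> root_triple tau hh (- e) (- f).
Proof.
move=> [[h1 h2 h3 h4] [h5 h6]]; split; last by split; apply: ad_nilpN.
split => //; [exact: (subspaceN (wsp_subspace _ _))|exact: (subspaceN (wsp_subspace _ _))|].
by rewrite lieNl lieNr opprK.
Qed.

(** The adjoint version of exp(e) exp(-f) exp(e), which in SL2 is the matrix with rows (0, 1) and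
    (-1, 0), the usual lift of the reflection. *)
Definition refl_auto e f x : L := expad e (expad (- f) (expad e x)).

Section Triple.
Variables (tau : 'Hom(h, K^o)) (hh : h) (e f : L).
Hypothesis ef : root_triple tau hh e f.

Let r := refl_auto e f.

Lemma refl_autoZ a x : r (a *: x) = a *: r x.
Proof.
case: ef => [_ [ne nf]]; have nf' := ad_nilpN nf.
by rewrite /r /refl_auto !expadZ.
Qed.

Lemma refl_autoL x y : r (lie x y) = lie (r x) (r y).
Proof.
case: ef => [_ [ne nf]]; have nf' := ad_nilpN nf.
by rewrite /r /refl_auto !expadL.
Qed.

Lemma refl_autoNK x : refl_auto (- e) (- f) (r x) = x.
Proof.
case: ef => [_ [ne nf]]; have nf' := ad_nilpN nf.
rewrite /r /refl_auto opprK expadNK //; have := expadNK nf'.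
by rewrite opprK => ->; rewrite expadNK.
Qed.

Lemma refl_auto_stable (S : set L) : subspace S -> (forall y, S y -> S (lie e y)) ->
  (forall y, S y -> S (lie f y)) -> forall y, S y -> S (r y).
Proof.
move=> hS he hf y Sy; rewrite /r /refl_auto.
have h' z : S z -> S (lie (- f) z) by rewrite lieNl => /hf; apply: subspaceN.
by do 3! [apply: expad_stable => //].
Qed.

Lemma refl_evalN t : (tau (t - (tau t : K) *: hh) : K) = - tau t.
Proof.
case: ef => [[_ _ _ th] _]; rewrite linearB linearZ /= th.
by rewrite /GRing.scale /= mulr_natr mulr2n opprD addrA subrr add0r.
Qed.

(** The computation stays in the span of the Cartan subalgebra, [e] and [f], where the exponential
    series stop at the quadratic term; the components along [e] and [f] cancel. *)
Lemma refl_auto_iota t : r (iota t) = iota (t - (tau t : K) *: hh).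
Proof.
case: ef => [[we wf eef th] [ne nf]]; have nf' := ad_nilpN nf.
have et u : lie e (iota u) = - (tau u : K) *: e by rewrite lieC we scaleNr.
have ft u : lie (- f) (iota u) = - (tau u : K) *: f.
  by rewrite lieNl -lieC wf opp_lfunE.
have Ee u : expad e (iota u) = iota u - (tau u : K) *: e.
  rewrite expad_iter2 /= ?et ?scaleNr //.
  by rewrite lieNr lieZr lie_alt scaler0 oppr0.
have Ef u : expad (- f) (iota u) = iota u - (tau u : K) *: f.
  rewrite expad_iter2 /= ?ft ?scaleNr //.
  by rewrite lieNr lieZr lieNl lie_alt oppr0 scaler0 oppr0.
have fe : lie (- f) e = iota hh by rewrite lieNl -lieC.
have Efe : expad (- f) e = e + iota hh - f.
  have e2 : lie (- f) (lie (- f) e) = - (2 *: f) by rewrite fe ft th scaleNr.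
  rewrite expad_iter3 /= ?e2 ?fe; last by rewrite lieNr lieZr lieNl lie_alt oppr0 scaler0 oppr0.
  by rewrite scalerN scalerA mulVf ?scale1r // pnatr_eq0.
have Eee : expad e e = e.
  by rewrite expad_iter2 /= lie_alt ?addr0 // lie0r.
have Eef : expad e f = f + iota hh - e.
  have e2 : lie e (lie e f) = - (2 *: e) by rewrite eef et th scaleNr.
  rewrite expad_iter3 /= ?e2 ?eef; last by rewrite lieNr lieZr lie_alt scaler0 oppr0.
  by rewrite scalerN scalerA mulVf ?scale1r // pnatr_eq0.
rewrite /r /refl_auto Ee -scaleNr expadD // expadZ // Ef Efe.
have -> : iota t - (tau t : K) *: f + - (tau t : K) *: (e + iota hh - f) =
  iota (t - (tau t : K) *: hh) - (tau t : K) *: e.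
  have hi : iota (t - (tau t : K) *: hh) = iota t - (tau t : K) *: iota hh.
    by rewrite linearB linearZ.
  rewrite hi !scaleNr !scalerDr scalerN.
  set a := _ *: f; set b := _ *: e; set c := _ *: _.
  rewrite !opprD opprK -(addrA (iota t)) [- a + _]addrC addrK.
  by rewrite -!addrA [- c - b]addrC.
rewrite -[- (_ *: e)]scaleNr expadD // expadZ // Eee Ee scaleNr.
by rewrite refl_evalN scaleNr opprK addrK.
Qed.

(** As the reflection on [h] is an involution, [iota t] is the image of the reflected [t]; since the
    map is an automorphism, [t, r x] = r [s t, x]. *)
Lemma refl_auto_wsp mu x : wsp mu x -> wsp (mu - (mu hh : K) *: tau) (r x).
Proof.
move=> wx t; case: (ef) => [[_ _ _ th] _].
have e1 : iota t = r (iota (t - (tau t : K) *: hh)).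
  by rewrite refl_auto_iota refl_evalN scaleNr opprK addrNK.
rewrite {1}e1 -refl_autoL wx refl_autoZ; congr (_ *: _).
rewrite linearB linearZ /= add_lfunE opp_lfunE scale_lfunE.
by rewrite /GRing.scale /= mulrC.
Qed.

End Triple.

Lemma refl_autoK tau hh e f : root_triple tau hh e f ->
  forall x, refl_auto e f (refl_auto (- e) (- f) x) = x.
Proof.
by move=> ef x; have := refl_autoNK (root_tripleN ef) x; rewrite !opprK.
Qed.

Lemma iter_refl_auto tau hh e f x : root_triple tau hh e f -> forall n y,
  iter n (lie (refl_auto e f x)) (refl_auto e f y) = refl_auto e f (iter n (lie x) y).
Proof. by move=> ef; elim=> //= n IH y; rewrite IH (refl_autoL ef). Qed.

Lemma ad_nilp_refl_auto tau hh e f x : root_triple tau hh e f ->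
  ad_nilp x -> ad_nilp (refl_auto e f x).
Proof.
move=> ef nx y; have [N eN] := nx (refl_auto (- e) (- f) y); exists N.
have := iter_refl_auto x ef N (refl_auto (- e) (- f) y).
rewrite (refl_autoK ef) eN => ->.
by have := refl_autoZ ef 0 0; rewrite !scale0r.
Qed.

Lemma root_triple_refl tau hh e f tau' hh' e' f' :
  root_triple tau hh e f -> root_triple tau' hh' e' f' ->
  root_triple (tau' - (tau' hh : K) *: tau) (hh' - (tau hh' : K) *: hh)
     (refl_auto e f e') (refl_auto e f f').
Proof.
move=> ef ef'; have [[we wf eef th] _] := ef; have [[we' wf' eef' th'] [ne nf]] := ef'.
split; last by split; apply: (ad_nilp_refl_auto ef).
split.
- exact: refl_auto_wsp.
- have := refl_auto_wsp ef wf'; rewrite opp_lfunE scaleNr opprK.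
  by rewrite opprB addrC.
- by rewrite -(refl_autoL ef) eef' (refl_auto_iota ef).
rewrite add_lfunE opp_lfunE scale_lfunE !linearB !linearZ /= th th'.
rewrite /GRing.scale /=; move: (tau hh' : K) (tau' hh : K) => a b; ring.
Qed.

End ReflectionAutomorphism.

(** * Fundamental coweights, the positive cone and the triangular decomposition of g *)

Lemma free_imageP (K : fieldType) (V : vectType K) n (v : 'I_n -> V) :
  free [seq v i | i : 'I_n] <->
  (forall k : 'I_n -> K, \sum_i k i *: v i = 0 -> forall i, k i = 0).
Proof.
have E : [seq v i | i : 'I_n] = [tuple v i | i < n] :> seq V.
  by [].
have F (k : 'I_n -> K) : \sum_i k i *: [tuple v i | i < n]`_i = \sum_i k i *: v i.
  by apply: eq_bigr => i _; rewrite -tnth_nth tnth_mktuple.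
rewrite E; split=> [/freeP h k|h]; first by rewrite -F => /h.
by apply/freeP => k; rewrite F => /h.
Qed.

(** Freeness says that the matrix of values of the [alpha j] on a basis of [h] has rank n; the rows
    of a left inverse are the coordinates of the [om i]. *)
Lemma dual_basis_exists (K : fieldType) (h : vectType K) n (alpha : 'I_n -> 'Hom(h, K^o)) :
  free [seq alpha i | i : 'I_n] ->
  exists om : 'I_n -> h, forall i j, alpha j (om i) = (i == j)%:R.
Proof.
move/free_imageP => fr.
pose X := vbasis {:h}.
pose M : 'M[K]_(\dim {:h}, n) := \matrix_(k, j) (alpha j X`_k : K).
have full : row_full M.
  rewrite /row_full -mxrank_tr; change (row_free M^T); rewrite -kermx_eq0.
  apply/eqP/row_matrixP => r; rewrite row0.
  set c := row r _.
  have cM : c *m M^T = 0 by rewrite /c -row_mul mulmx_ker row0.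
  have c0 : forall i, c 0 i = 0.
    apply: fr; apply/lfunP => x; rewrite [RHS]lfunE /=.
    rewrite (coord_vbasis (memvf x)) linear_sum big1 // => k _.
    rewrite linearZ /= sum_lfunE; apply/eqP; rewrite scaler_eq0; apply/orP; right.
    have := congr1 (fun N : 'rV_ _ => N 0 k) cM; rewrite !mxE => e0.
    apply/eqP; rewrite -[RHS]e0; apply: eq_bigr => j _.
    by rewrite !mxE lfunE /=.
  by apply/rowP => i; rewrite c0 mxE.
have /row_fullP [B BM] := full.
exists (fun i => \sum_k B i k *: X`_k) => i j.
have := congr1 (fun N : 'M_ _ => N i j) BM; rewrite !mxE => <-.
by rewrite linear_sum; apply: eq_bigr => k _; rewrite linearZ /= !mxE.
Qed.

Lemma lfun_mulrnE (K : fieldType) (U V : vectType K) (v : 'Hom(U, V)) m x :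
  (v *+ m) x = v x *+ m.
Proof. by elim: m => [|m IH]; rewrite ?lfunE // !mulrSr add_lfunE IH. Qed.

Section KacMoody.
Variables (K : numFieldType) (n : nat) (A : 'M[int]_n) (h : vectType K)
  (alpha : 'I_n -> 'Hom(h, K^o)) (alphav : 'I_n -> h) (L : lieAlgType K)
  (iota : {linear h -> L}) (e f : 'I_n -> L).
Implicit Types (lam mu : 'Hom(h, K^o)) (x y : L).

Definition Qp lam := exists k : 'I_n -> nat, lam = \sum_i alpha i *+ k i.

(** With [C = xpredT] this is the positive cone without 0; with [C = predC1 i] it consists of the
    weights that involve a simple root other than [alpha i]. *)
Definition Qpos (C : pred 'I_n) lam :=
  exists k : 'I_n -> nat, (exists2 j, C j & (0 < k j)%N) /\ lam = \sum_i alpha i *+ k i.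

Lemma Qp0 : Qp 0.
Proof. by exists (fun=> 0%N); rewrite big1. Qed.

Lemma QpD lam mu : Qp lam -> Qp mu -> Qp (lam + mu).
Proof.
move=> [k ->] [k' ->]; exists (fun i => (k i + k' i)%N).
by rewrite -big_split; apply: eq_bigr => i _; rewrite mulrnDr.
Qed.

Lemma Qpos_sum i m : \sum_j alpha j *+ ((j == i) * m) = alpha i *+ m.
Proof.
rewrite (bigD1 i) //= eqxx mul1n big1 ?addr0 // => j /negbTE ->.
by rewrite mul0n mulr0n.
Qed.

Lemma Qp_simple i : Qp (alpha i).
Proof. by exists (fun j => (j == i) * 1)%N; rewrite Qpos_sum. Qed.

Lemma Qpos_Qp C lam : Qpos C lam -> Qp lam.
Proof. by move=> [k [_ ->]]; exists k. Qed.

Lemma Qpos_simple (C : pred 'I_n) i : C i -> Qpos C (alpha i).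
Proof.
move=> Ci; exists (fun j => (j == i) * 1)%N; rewrite Qpos_sum; split=> //.
by exists i => //; rewrite eqxx.
Qed.

Lemma QposD C lam mu : Qpos C lam -> Qp mu -> Qpos C (lam + mu).
Proof.
move=> [k [[j Cj kj] ->]] [k' ->]; exists (fun i => (k i + k' i)%N); split.
  by exists j => //; rewrite addn_gt0 kj.
by rewrite -big_split; apply: eq_bigr => i _; rewrite mulrnDr.
Qed.

Lemma Qp_eval lam (om : 'I_n -> h) (k : 'I_n -> nat) j :
  (forall i j, alpha j (om i) = (i == j)%:R) ->
  lam = \sum_i alpha i *+ k i -> lam (om j) = (k j)%:R.
Proof.
move=> hom ->; rewrite sum_lfunE (bigD1 j) //= big1 => [|i ij].
  by rewrite lfun_mulrnE hom eqxx addr0.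
by rewrite lfun_mulrnE hom eq_sym (negbTE ij) mul0rn.
Qed.

Hypothesis km : kac_moody_axioms A alpha alphav iota e f.

Lemma km_om : exists om : 'I_n -> h, forall i j, alpha j (om i) = (i == j)%:R.
Proof. by case: (km_realization km) => fr _ _ _; apply: dual_basis_exists. Qed.

Lemma iota_comm (x y : h) : lie (iota x) (iota y) = 0.
Proof. exact: (km_hh km). Qed.

(* This symmetry transfers every statement about the e_i to the f_i. *)
Lemma kac_moody_swap :
  kac_moody_axioms A (fun i => - alpha i) (fun i => - alphav i) iota f e.
Proof.
case: km => g1 g2 g3 g4 g5 g6 g7 g8 g9; split => //.
- case: g2 => /free_imageP h1 /free_imageP h2 h3 h4; split => //.
  + apply/free_imageP => k; under eq_bigr => i _ do rewrite scalerN -scaleNr.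
    by move=> /h1 hk i; have := hk i => /eqP; rewrite oppr_eq0 => /eqP.
  + apply/free_imageP => k; under eq_bigr => i _ do rewrite scalerN -scaleNr.
    by move=> /h2 hk i; have := hk i => /eqP; rewrite oppr_eq0 => /eqP.
  + by move=> i j; rewrite opp_lfunE linearN /= opprK h3.
- by move=> x i; rewrite g6 opp_lfunE.
- by move=> x i; rewrite g5 opp_lfunE opprK.
- move=> i j; rewrite lieC g7 eq_sym; case: eqP => [->|_]; last by rewrite oppr0.
  by rewrite linearN.
- by rewrite -g8 -!setUA [range f `|` _]setUC.
Qed.

Lemma wsp_e i : wsp iota (alpha i) (e i).
Proof. by move=> t; rewrite (km_he km). Qed.

Lemma wsp_f i : wsp iota (- alpha i) (f i).
Proof. by move=> t; rewrite (km_hf km) opp_lfunE. Qed.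

Lemma nplus_wsum : lie_gen (range e) `<=` wsum iota (Qpos xpredT).
Proof.
apply: lie_gen_min.
  split; first exact: wsum_subspace.
  by move=> x y; apply: wsumL => lam mu hl /Qpos_Qp; apply: QposD.
by move=> _ [i _ <-]; apply: (wsum_sub (mu := alpha i)); [apply: Qpos_simple|apply: wsp_e].
Qed.

(** Since [e_i, e_i] = 0, every bracket in n+ involves a simple root other than [alpha i]. Hence no
    multiple m alpha_i with m > 1 can be a root. *)
Lemma nplus_wsum1 i x : lie_gen (range e) x ->
  exists c w, wsum iota (Qpos (predC1 i)) w /\ x = c *: e i + w.
Proof.
have hS := wsum_subspace iota (Qpos (predC1 i)).
pose S : set L := [set x | exists c w,
  wsum iota (Qpos (predC1 i)) w /\ x = c *: e i + w].
suff: lie_gen (range e) `<=` S by apply.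
have eiw y : wsum iota (Qpos (predC1 i)) y -> wsum iota (Qpos (predC1 i)) (lie (e i) y).
  have : wsum iota [set alpha i] (e i) by apply: wsum_sub (wsp_e i).
  by apply: wsumL => _ mu -> hm; rewrite addrC; apply: QposD => //; apply: Qp_simple.
apply: lie_gen_min; last first.
  move=> _ [j _ <-]; have [->|ji] := eqVneq j i.
    by exists 1, 0; rewrite scale1r addr0; split=> //; apply: (subspace0 hS).
  exists 0, (e j); rewrite scale0r add0r; split=> //.
  by apply: (wsum_sub (mu := alpha j)); [apply: Qpos_simple|apply: wsp_e].
split; first split.
- by exists 0, 0; rewrite scale0r addr0; split=> //; apply: (subspace0 hS).
- move=> a x1 y1 [c [w [hw ->]]] [c' [w' [hw' ->]]].
  exists (a * c + c'), (a *: w + w'); split; first exact: (subspaceP _ hS).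
  by rewrite scalerDr scalerDl scalerA addrACA.
move=> x1 y1 [c [w [hw ->]]] [c' [w' [hw' ->]]].
exists 0, (lie (c *: e i + w) (c' *: e i + w')); split; last by rewrite scale0r add0r.
rewrite lieDl lieZl lieDr lieZr lie_alt scaler0 add0r lieDr lieZr.
apply: (subspaceD hS); first by apply: (subspaceZ _ hS); apply: eiw.
apply: (subspaceD hS); last by apply: wsumL hw hw' => lam mu hl /Qpos_Qp; apply: QposD.
by rewrite lieC scalerN -scaleNr; apply: (subspaceZ _ hS); apply: eiw.
Qed.

Lemma km_triangular x : exists a t c,
  [/\ lie_gen (range f) a, lie_gen (range e) c & x = a + iota t + c].
Proof.
have : lie_gen (range iota `|` range e `|` range f) x by rewrite (km_gen km).
have hH : subspace (range iota).
  split; first by exists 0; rewrite ?linear0.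
  by move=> a _ _ [t _ <-] [u _ <-]; exists (a *: t + u); rewrite // linearP.
case/lie_gen_triangular => //.
- by move=> _ _ [t _ <-] [u _ <-]; rewrite iota_comm; apply: (subspace0 hH).
- move=> _ _ [i _ <-] [j _ <-]; rewrite (km_ef km); case: eqP => _; first by exists (alphav i).
  exact: (subspace0 hH).
- move=> _ _ [t _ <-] [j _ <-]; rewrite (km_he km).
  by apply: (subspaceZ _ (lie_gen_subspace _)); apply: sub_lie_gen; exists j.
- move=> _ _ [t _ <-] [j _ <-]; rewrite (km_hf km).
  by apply: (subspaceZ _ (lie_gen_subspace _)); apply: sub_lie_gen; exists j.
by move=> a [b [c [ha [t _ <-] hc ->]]]; exists a, t, c.
Qed.

End KacMoody.

(** * Serre relations and local nilpotency of ad e_i *)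

Section Integrability.
Variables (K : numFieldType) (n : nat) (A : 'M[int]_n) (h : vectType K)
  (alpha : 'I_n -> 'Hom(h, K^o)) (alphav : 'I_n -> h) (L : lieAlgType K)
  (iota : {linear h -> L}) (e f : 'I_n -> L).
Hypothesis km : kac_moody_axioms A alpha alphav iota e f.
Implicit Types (lam mu : 'Hom(h, K^o)) (x y : L).

Lemma nminus_wsum : lie_gen (range f) `<=` wsum iota [set lam | Qp alpha (- lam)].
Proof.
move=> x /(nplus_wsum (kac_moody_swap km)); apply: wsum_mono => lam [k [_ ->]].
by exists k; rewrite -sumrN; apply: eq_bigr => i _; rewrite mulNrn opprK.
Qed.

Lemma root_Qp lam x : wsp iota lam x -> x != 0 -> Qp alpha lam \/ Qp alpha (- lam).
Proof.
move=> wx x0; apply: contrapT => hl; case/eqP: x0.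
apply: (wsum_indep _ wx hl) => //.
have [a [t [c [ha hc ->]]]] := km_triangular km x.
have hS := wsum_subspace iota [set lam | Qp alpha lam \/ Qp alpha (- lam)].
apply: (subspaceD hS); first apply: (subspaceD hS).
- by have := nminus_wsum ha; apply: wsum_mono => mu; right.
- apply: (wsum_sub (mu := 0)); first by left; apply: Qp0.
  exact: (wsp_iota (iota_comm km)).
- by have := nplus_wsum km hc; apply: wsum_mono => mu /Qpos_Qp; left.
Qed.

Lemma simple_mulrn_root i m x : wsp iota (alpha i *+ m) x -> x != 0 -> (m <= 1)%N.
Proof.
move=> wx x0; rewrite leqNgt; apply/negP => m1; case/eqP: x0.
have [om hom] := km_om km.
pose P : set 'Hom(h, K^o) :=
  [set lam | Qp alpha (- lam) \/ lam = alpha i \/ Qpos alpha (predC1 i) lam].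
have hS := wsum_subspace iota P.
apply: (wsum_indep (P := P) _ wx).
  have [a [t [c [ha hc ->]]]] := km_triangular km x.
  apply: (subspaceD hS); first apply: (subspaceD hS).
  - by have := nminus_wsum ha; apply: wsum_mono => mu; left.
  - apply: (wsum_sub (mu := 0)); first by left; rewrite oppr0; apply: Qp0.
    exact: (wsp_iota (iota_comm km)).
  - have [b [w [hw ->]]] := nplus_wsum1 km i hc; apply: (subspaceD hS).
      by apply: (subspaceZ _ hS); apply: wsum_sub (wsp_e km i); right; left.
    by have := hw; apply: wsum_mono => mu; right; right.
have E j : (alpha i *+ m) (om j) = ((j == i) * m)%:R.
  by apply: (Qp_eval j hom (k := fun j => (j == i) * m)%N); rewrite Qpos_sum.
case=> [[k hk]|[hk|[k [[j ji kj] hk]]]].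
- have := Qp_eval i hom hk; rewrite opp_lfunE E eqxx mul1n => /eqP.
  rewrite -subr_eq0 -opprD oppr_eq0 -natrD pnatr_eq0 addn_eq0.
  by case: (m) m1.
- have := E i; rewrite hk hom eqxx mul1n => /eqP; rewrite eqr_nat.
  by case: (m) m1 => [|[]].
- have := Qp_eval j hom hk; rewrite E (negbTE ji) => /eqP; rewrite eqr_nat.
  by case: (k j) kj.
Qed.

(* The span of the e_{i1} .. e_{ik} x is an ideal without weight 0. *)
Lemma singular_eq0 lam x : wsp iota lam x -> Qpos alpha xpredT lam ->
  (forall k, lie (f k) x = 0) -> x = 0.
Proof.
move=> wx hl fx.
pose C (S : set L) := subspace S /\ forall k y, S y -> S (lie (e k) y).
pose J := smallest C [set x].
have Jmin S : C S -> S x -> J `<=` S.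
  by move=> CS Sx; apply: smallest_sub => // y ->.
have CJ : C J.
  split; first split.
  - by move=> S [[[S0 _] _] _].
  - move=> a y z Jy Jz S hS; case: (hS) => [[h0 _] _].
    by apply: (subspaceP _ h0); [apply: Jy|apply: Jz].
  - by move=> k y Jy S hS; case: (hS) => [[_ h0] _]; apply: h0; apply: Jy.
have Jx : J x by move=> S [_]; apply.
have [hJ Je] := CJ.
have Jh : forall t y, J y -> J (lie (iota t) y).
  move=> t y Jy; suff: J `<=` [set y | J y /\ forall t, J (lie (iota t) y)].
    by move=> /(_ _ Jy) [_]; apply.
  apply: Jmin; last by split=> // u; rewrite wx; apply: (subspaceZ _ hJ).
  split; first split.
  - by split; [apply: (subspace0 hJ)|move=> u; rewrite lie0r; apply: (subspace0 hJ)].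
  - move=> a z z' [h1 h2] [h1' h2']; split; first exact: (subspaceP _ hJ).
    by move=> u; rewrite lieDr lieZr; apply: (subspaceP _ hJ).
  move=> k z [h1 h2]; split; first exact: Je.
  move=> u; rewrite lie_der (km_he km) lieZl.
  by apply: (subspaceP _ hJ); apply: Je.
have Jf : forall l y, J y -> J (lie (f l) y).
  move=> l y Jy; suff: J `<=` [set y | J y /\ forall t, J (lie (f t) y)].
    by move=> /(_ _ Jy) [_]; apply.
  apply: Jmin; last by split=> // u; rewrite fx; apply: (subspace0 hJ).
  split; first split.
  - by split; [apply: (subspace0 hJ)|move=> u; rewrite lie0r; apply: (subspace0 hJ)].
  - move=> a z z' [h1 h2] [h1' h2']; split; first exact: (subspaceP _ hJ).
    by move=> u; rewrite lieDr lieZr; apply: (subspaceP _ hJ).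
  move=> k z [h1 h2]; split; first exact: Je.
  move=> u; rewrite lie_der; apply: (subspaceD hJ); last exact: Je.
  rewrite [lie (f u) _]lieC (km_ef km) lieNl; apply: (subspaceN hJ).
  by case: eqP => _; [apply: Jh|rewrite lie0l; apply: (subspace0 hJ)].
have idJ : lie_ideal J.
  split=> // y z Jz.
  have : lie_gen (range iota `|` range e `|` range f) y by rewrite (km_gen km).
  suff sub : lie_gen (range iota `|` range e `|` range f) `<=`
      [set y | forall z, J z -> J (lie y z)] by move=> /sub; apply.
  apply: lie_gen_min; last first.
    by move=> _ [[[t _ <-]|[i _ <-]]|[i _ <-]] u Ju; [apply: Jh|apply: Je|apply: Jf].
  split; first split.
  - by move=> u _; rewrite lie0l; apply: (subspace0 hJ).
  - move=> a u v hu hv w Jw; rewrite lieDl lieZl.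
    by apply: (subspaceP _ hJ); [apply: hu|apply: hv].
  - move=> u v hu hv w Jw; have -> : lie (lie u v) w = lie u (lie v w) - lie v (lie u w).
      by rewrite lie_der addrK.
    apply: (subspaceD hJ); first exact: (hu _ (hv _ Jw)).
    by apply: (subspaceN hJ); exact: (hv _ (hu _ Jw)).
have Jw : J `<=` wsum iota (Qpos alpha xpredT).
  apply: Jmin; last exact: wsum_sub wx.
  split; first exact: wsum_subspace.
  move=> k y hy; rewrite lieC; apply: (subspaceN (wsum_subspace _ _)).
  have : wsum iota [set alpha k] (e k) by apply: wsum_sub (wsp_e km k).
  by move: hy; apply: wsumL => mu _ hm ->; apply: QposD => //; apply: Qp_simple.
have [om hom] := km_om km.
have J0 : J = [set 0].
  apply: (km_noideal km idJ) => y [Jy [t _ ty]].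
  apply: (wsum_indep (Jw _ Jy) (lam := 0)); first by rewrite -ty; exact: (wsp_iota (iota_comm km)).
  move=> [k [[j _ kj] hk]]; have := Qp_eval j hom hk; rewrite lfunE /= => /eqP.
  by rewrite eq_sym pnatr_eq0; case: (k j) kj.
by move: Jx; rewrite J0.
Qed.

(** The sl2 computation for a vector killed by f_i and of weight A_ij under the coroot. The
    coefficient vanishes at k = -A_ij, which fixes the order in the Serre relation. *)
Lemma lie_f_iter i j k : i != j ->
  lie (f i) (iter k.+1 (lie (e i)) (e j)) =
  - (k.+1%:R * ((A i j)%:~R + k%:R)) *: iter k (lie (e i)) (e j).
Proof.
move=> ij; have [_ _ ha _] := km_realization km.
have Aii : (A i i)%:~R = 2 :> K by case: (km_gcm km) => ->.
have fe : lie (f i) (e i) = - iota (alphav i) by rewrite lieC (km_ef km) eqxx.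
have hw m : lie (iota (alphav i)) (iter m (lie (e i)) (e j)) =
    ((A i j)%:~R + 2 * m%:R) *: iter m (lie (e i)) (e j).
  elim: m => [|m IH]; first by rewrite (km_he km) ha mulr0 addr0.
  rewrite /= lie_der IH (km_he km) ha Aii lieZl lieZr -scalerDl.
  by congr (_ *: _); rewrite -[m.+1%:R]natr1; ring.
elim: k => [|k IH].
  rewrite /= lie_der fe (_ : lie (f i) (e j) = 0) ?lie0r ?addr0.
    by rewrite lieNl (km_he km) ha -scaleNr; congr (_ *: _); ring.
  by rewrite lieC (km_ef km) eq_sym (negbTE ij) oppr0.
rewrite [iter k.+2 _ _]iterS lie_der fe IH lieNl hw lieZr -iterS -scaleNr -scalerDl.
congr (_ *: _); rewrite -opprD; congr (- _).
rewrite -[k.+2%:R]natr1 -[k.+1%:R]natr1.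
by move: ((A i j)%:~R : K) (k%:R : K) => a b; ring.
Qed.

Lemma wsp_iter lam mu x y k : wsp iota lam x -> wsp iota mu y ->
  wsp iota (mu + lam *+ k) (iter k (lie x) y).
Proof.
move=> wx wy; elim: k => [|k IH]; first by rewrite addr0.
by rewrite mulrS addrCA; apply: wspL.
Qed.

(** The vector (ad e_i)^(1 - A_ij) e_j is killed by every f_k, so it is singular of positive weight
    and must vanish. *)
Lemma serre_e i j : i != j -> exists m, iter m (lie (e i)) (e j) = 0.
Proof.
move=> ij; have [_ _ ha _] := km_realization km; have [_ hA hA0] := km_gcm km.
pose m := absz (A i j); exists m.+1.
have Am : A i j = - (m : int) by rewrite /m abszE ler0_norm ?opprK // hA.
apply: (singular_eq0 (wsp_iter m.+1 (wsp_e km i) (wsp_e km j))).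
  apply: QposD; first exact: Qpos_simple.
  by exists (fun j => (j == i) * m.+1)%N; rewrite Qpos_sum.
move=> k; have [->|ki] := eqVneq k i.
  rewrite lie_f_iter // Am mulrNz (_ : - _ + _ = 0) ?mulr0 ?oppr0 ?scale0r //.
  by rewrite addrC subrr.
have comm p y : lie (f k) (iter p (lie (e i)) y) = iter p (lie (e i)) (lie (f k) y).
  elim: p => //= p IH; rewrite lie_der IH lieC [lie (f k) _]lieC (km_ef km).
  by rewrite eq_sym (negbTE ki) oppr0 lie0r oppr0 add0r.
rewrite comm [lie (f k) _]lieC (km_ef km); case: eqP => [jk|_]; last by rewrite oppr0 iter_lie0.
have ei : lie (e i) (iota (alphav j)) = - (A j i)%:~R *: e i.
  by rewrite lieC (km_he km) ha scaleNr.
rewrite -scaleN1r iter_lieZ iterSr ei iter_lieZ.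
(* Here k = j, and f_j turns e_j into a multiple A_ji of e_i. If A_ij is nonzero, a further ad e_i
   kills it; if A_ij = 0, then A_ji = 0 as well. *)
case: (m) Am => [|m' _]; last by rewrite iterSr lie_alt iter_lie0 !scaler0.
by rewrite oppr0 => /hA0 ->; rewrite oppr0 scale0r scaler0.
Qed.

(** By the Leibniz rule the vectors killed by some power of ad e_i form a subalgebra, so the
    generators decide. *)
Lemma ad_nilp_e i : ad_nilp (e i).
Proof.
move=> y.
have : lie_gen (range iota `|` range e `|` range f) y by rewrite (km_gen km).
suff sub : lie_gen (range iota `|` range e `|` range f) `<=`
    [set y | exists N, iter N (lie (e i)) y = 0] by apply: sub.
have gt N M y1 : iter N (lie (e i)) y1 = 0 -> (N <= M)%N -> iter M (lie (e i)) y1 = 0.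
  by move=> eN NM; apply: iter_lie_ge eN.
apply: lie_gen_min; last first.
  move=> _ [[[t _ <-]|[j _ <-]]|[j _ <-]].
  - by exists 2; rewrite /= [lie (e i) (iota t)]lieC (km_he km) lieNr lieZr lie_alt scaler0 oppr0.
  - have [<-|ij] := eqVneq i j; first by exists 1%N; rewrite /= lie_alt.
    exact: serre_e.
  - have [<-|ij] := eqVneq i j; last first.
      by exists 1%N; rewrite /= (km_ef km) (negbTE ij).
    exists 3; rewrite /= (km_ef km) eqxx [lie (e i) (iota _)]lieC (km_he km).
    by rewrite lieNr lieZr lie_alt scaler0 oppr0.
split; first split.
- by exists 0%N.
- move=> a u v [N eN] [M eM]; exists (maxn N M); rewrite iter_lieD iter_lieZ.
  by rewrite (gt _ _ _ eN) ?leq_maxl // (gt _ _ _ eM) ?leq_maxr // scaler0 addr0.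
move=> u v [N eN] [M eM]; exists (maxn N M + maxn N M)%N.
apply: iter_lieL0 (leqnn _); [apply: gt eN _|apply: gt eM _]; rewrite ?leq_maxl ?leq_maxr //.
Qed.

End Integrability.

(** * The sl2-triples of the simple roots *)

Section SimpleTriples.
Variables (K : numFieldType) (n : nat) (A : 'M[int]_n) (h : vectType K)
  (alpha : 'I_n -> 'Hom(h, K^o)) (alphav : 'I_n -> h) (L : lieAlgType K)
  (iota : {linear h -> L}) (e f : 'I_n -> L).
Hypothesis km : kac_moody_axioms A alpha alphav iota e f.

Lemma simple_root_triple i : root_triple iota (alpha i) (alphav i) (e i) (f i).
Proof.
split; last by split; [apply: (ad_nilp_e km)|apply: (ad_nilp_e (kac_moody_swap km))].
split; [exact: wsp_e km i|exact: wsp_f km i|by rewrite (km_ef km) eqxx|].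
by have [_ _ -> _] := km_realization km; case: (km_gcm km) => ->.
Qed.

Lemma simple_mulrn_rootN i m x : wsp iota (- (alpha i *+ m)) x -> x != 0 -> (m <= 1)%N.
Proof. by rewrite -mulNrn => wx; apply: (simple_mulrn_root (kac_moody_swap km) wx). Qed.

End SimpleTriples.

(** * The standard form, its nondegeneracy, and reflections on the dual of h *)

Section RowCombination.
Variables (K : fieldType) (h : vectType K) (m n : nat) (v : 'I_n -> h) (B : 'M[K]_(m, n)).

Definition mxcomb (y : 'rV[K]_m) : h := \sum_i (y *m B) 0 i *: v i.

Lemma mxcomb_linear : linear mxcomb.
Proof.
move=> a y z; rewrite /mxcomb scaler_sumr -big_split; apply: eq_bigr => i _ /=.
by rewrite mulmxDl -scalemxAl !mxE scalerDl scalerA.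
Qed.

HB.instance Definition _ := GRing.isLinear.Build K 'rV[K]_m h _ mxcomb mxcomb_linear.

End RowCombination.

Section Form.
Variables (K : numClosedFieldType) (g : symKacMoody K).
Local Notation h := (cartan g).
Local Notation V := 'Hom(h, K^o).
Local Notation alpha := (@simple_root K g).
Local Notation alphav := (@simple_coroot K g).
Local Notation form := (cartan_form g).
Local Notation df := (@dual_form K g).
Let km := km_axioms g.

Lemma form_sym x y : form x y = form y x.
Proof. by case: (km_standard g). Qed.

Lemma form_coroot i x : form (alphav i) x = km_eps g 0 i * alpha i x.
Proof. by case: (km_standard g). Qed.

Lemma eps_gt0 i : 0 < km_eps g 0 i.
Proof. by case: (km_symmetrization g). Qed.

Definition evalmx (x : h) : 'rV[K]_(km_n g) := \row_j (alpha j x : K).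

Lemma evalmx_linear : linear evalmx.
Proof. by move=> a x y; apply/rowP => j; rewrite !mxE linearP. Qed.

HB.instance Definition _ := GRing.isLinear.Build K h 'rV[K]_(km_n g) _ evalmx evalmx_linear.

(* The center has the dimension of the left kernel of A, which parametrizes its
   intersection with the span of the coroots. *)
Lemma center_sub_coroots x : (forall i, alpha i x = 0) ->
  exists c : 'rV[K]_(km_n g), x = \sum_i c 0 i *: alphav i.
Proof.
move=> x0; have [_ /free_imageP fr ha hdim] := km_realization km.
have [om hom] := km_om km.
set Ak := map_mx intr (km_A g) in hdim.
pose B := row_base (kermx Ak).
pose G := linfun (mxcomb alphav B).
pose F := linfun evalmx.
have kerG : lker G == 0%VS.
  rewrite -subv0; apply/subvP => y; rewrite memv_ker lfunE memv0 /= => /eqP /fr y0.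
  have : y *m B = 0 by apply/rowP => i; rewrite y0 mxE.
  move/eqP; rewrite -[X in _ == X](mul0mx _ B) => /eqP y0B; apply/eqP.
  exact: row_free_inj (row_base_free _) _ _ y0B.
have sub : (limg G <= lker F)%VS.
  apply/subvP => _ /memv_imgP [y _ ->]; rewrite memv_ker !lfunE /=; apply/eqP/rowP => j.
  rewrite !mxE linear_sum.
  have : y *m B *m Ak = 0.
    have /submxP [D ->] : (B <= kermx Ak)%MS by rewrite eq_row_base.
    by rewrite -mulmxA -(mulmxA D) mulmx_ker !mulmx0.
  move=> /(congr1 (fun M : 'rV_ _ => M 0 j)); rewrite mxE [RHS]mxE => e0; rewrite -[RHS]e0.
  by apply: eq_bigr => i _; rewrite linearZ /= ha [Ak i j]mxE.
have Ffull : limg F = fullv.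
  apply/eqP; rewrite eqEsubv subvf; apply/subvP => v _.
  apply/memv_imgP; exists (\sum_i v 0 i *: om i); first exact: memvf.
  rewrite lfunE /=; apply/rowP => j; rewrite mxE linear_sum (bigD1 j) //= big1.
    by rewrite linearZ /= hom eqxx addr0 /GRing.scale /= mulr1.
  by move=> i ij; rewrite linearZ /= hom (negbTE ij) scaler0.
(* As [F] is onto, its kernel has dimension (2n - rank A) - n = n - rank A, which is the dimension
   of the left kernel of A and hence of the image of the injective [G]. *)
have : limg G == lker F.
  rewrite eqEdim sub /= limg_dim_eq; last by apply/eqP; rewrite (eqP kerG) capv0.
  rewrite dimvf dim_matrix ?mul1n mxrank_ker.
  have := limg_ker_dim F fullv; rewrite capfv Ffull hdim dimvf dim_matrix ?mul1n.
  by have := rank_leq_row Ak; lia.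
move/eqP/vspaceP/(_ x); rewrite memv_ker lfunE /=.
have -> : evalmx x = 0 by apply/rowP => j; rewrite !mxE x0.
rewrite eqxx => /memv_imgP [y _]; rewrite lfunE /= => ->.
by exists (y *m B).
Qed.

(** A vector of the radical is killed by all simple roots, so it is a combination of the coroots;
    pairing it with the fundamental coweights shows that the coefficients, each times a positive
    [km_eps], are 0. *)
Lemma form_nondegenerate x : (forall y, form x y = 0) -> x = 0.
Proof.
move=> x0; have [om hom] := km_om km.
have [i|c xc] := center_sub_coroots (x := x).
  apply/eqP; have := form_coroot i x; rewrite form_sym x0 => /esym/eqP.
  by rewrite mulf_eq0 gt_eqF ?eps_gt0.
rewrite xc big1 // => i _; have := x0 (om i).
rewrite xc linear_sumlz (bigD1 i) //= big1 ?addr0; last first.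
  by move=> j ji; rewrite linearZl_LR /= form_coroot hom eq_sym (negbTE ji) mulr0 scaler0.
rewrite linearZl_LR /= form_coroot hom eqxx mulr1 => /eqP.
by rewrite mulf_eq0 [_ == 0 in X in _ || X]gt_eqF ?eps_gt0 // orbF => /eqP ->; rewrite scale0r.
Qed.

Definition form_hom (x : h) : V := linfun (form x).

Lemma form_homE x y : form_hom x y = form x y.
Proof. by rewrite lfunE. Qed.

Lemma form_hom_linear : linear form_hom.
Proof.
move=> a x y; apply/lfunP => t.
by rewrite add_lfunE scale_lfunE !form_homE linearPl.
Qed.

HB.instance Definition _ := GRing.isLinear.Build K h V _ form_hom form_hom_linear.

Lemma form_nuE x y : form_nu g x y = form x y.
Proof. by rewrite /form_nu -/form_hom (lfunE form_hom) form_homE. Qed.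

Lemma form_nu_ker0 : lker (form_nu g) == 0%VS.
Proof.
rewrite -subv0; apply/subvP => x; rewrite memv_ker memv0 => /eqP nx0; apply/eqP.
by apply: form_nondegenerate => y; rewrite -form_nuE nx0 lfunE.
Qed.

Lemma form_nu_full : limg (form_nu g) = fullv.
Proof.
apply/eqP; rewrite eqEdim subvf limg_dim_eq; last by apply/eqP; rewrite (eqP form_nu_ker0) capv0.
rewrite !dimvf; have -> : dim V = (dim h * 1)%N by [].
by rewrite muln1 /=.
Qed.

Definition nuinv (lam : V) : h := ((form_nu g)^-1%VF lam).

Lemma nuinvK lam : form_nu g (nuinv lam) = lam.
Proof. by apply: limg_lfunVK; rewrite form_nu_full memvf. Qed.

Lemma dfE (lam mu : V) : df lam mu = lam (nuinv mu).
Proof. by rewrite /dual_form -form_nuE nuinvK. Qed.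

Lemma df_sym lam mu : df lam mu = df mu lam.
Proof. by rewrite /dual_form form_sym. Qed.

Lemma dfDl lam lam' mu : df (lam + lam') mu = df lam mu + df lam' mu.
Proof. by rewrite !dfE add_lfunE. Qed.

Lemma dfZl a lam mu : df (a *: lam) mu = a * df lam mu.
Proof. by rewrite !dfE scale_lfunE. Qed.

Lemma dfDr lam mu mu' : df lam (mu + mu') = df lam mu + df lam mu'.
Proof. by rewrite df_sym dfDl !(df_sym lam). Qed.

Lemma dfZr a lam mu : df lam (a *: mu) = a * df lam mu.
Proof. by rewrite df_sym dfZl df_sym. Qed.

Lemma nuinv_simple i : nuinv (alpha i) = (km_eps g 0 i)^-1 *: alphav i.
Proof.
have inj : injective (form_nu g) by apply/lker0P/form_nu_ker0.
apply: inj; rewrite nuinvK; apply/lfunP => x.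
rewrite form_nuE linearZl_LR /= form_coroot /GRing.scale /= mulrA mulVf ?mul1r //.
by rewrite gt_eqF ?eps_gt0.
Qed.

Lemma df_simple (lam : V) i : df lam (alpha i) = lam (alphav i) / km_eps g 0 i.
Proof. by rewrite dfE nuinv_simple linearZ /= mulrC. Qed.

Definition coroot (tau : V) : h := (2 / df tau tau) *: nuinv tau.

Lemma coroot_eval (lam tau : V) : lam (coroot tau) = 2 * df lam tau / df tau tau.
Proof. by rewrite linearZ /= -dfE /GRing.scale /= mulrAC. Qed.

Lemma reflectionE (lam tau : V) :
  reflection tau lam = lam - (lam (coroot tau) : K) *: tau.
Proof. by rewrite coroot_eval. Qed.

Lemma simple_norm i : df (alpha i) (alpha i) = 2 / km_eps g 0 i.
Proof.
by rewrite df_simple; have [_ _ -> _] := km_realization km; case: (km_gcm km) => ->.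
Qed.

Lemma coroot_simple i : coroot (alpha i) = alphav i.
Proof.
have e0 : km_eps g 0 i != 0 by rewrite gt_eqF ?eps_gt0.
rewrite /coroot simple_norm nuinv_simple scalerA.
by rewrite [X in X *: _](_ : _ = 1) ?scale1r //; field.
Qed.

Section Reflection.
Variable tau : V.
Hypothesis tau0 : df tau tau != 0.
Implicit Types lam mu : V.

Lemma coroot_self : tau (coroot tau) = 2.
Proof. by rewrite coroot_eval mulfK. Qed.

Lemma reflection_self : reflection tau tau = - tau.
Proof.
rewrite reflectionE coroot_self -{1}[tau]scale1r -scalerBl -scaleN1r.
by congr (_ *: _); ring.
Qed.

Lemma reflectionP a lam mu :
  reflection tau (a *: lam + mu) = a *: reflection tau lam + reflection tau mu.
Proof.
rewrite !reflectionE add_lfunE scale_lfunE scalerBr scalerA scalerDl opprD.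
by rewrite addrACA.
Qed.

Lemma reflectionK lam : reflection tau (reflection tau lam) = lam.
Proof.
rewrite [reflection tau lam]reflectionE reflectionE add_lfunE opp_lfunE scale_lfunE.
rewrite coroot_self -addrA -opprD -scalerDl.
have -> : (lam (coroot tau) : K) + (lam (coroot tau) - lam (coroot tau) *: (2 : K^o)) = 0.
  by rewrite /GRing.scale /=; ring.
by rewrite scale0r subr0.
Qed.

Lemma reflection_df lam mu : df (reflection tau lam) (reflection tau mu) = df lam mu.
Proof.
rewrite !reflectionE !coroot_eval -!scaleNr !(dfDl, dfDr, dfZl, dfZr) (df_sym tau mu).
by field.
Qed.

Lemma reflection_coroot lam mu : df mu mu != 0 ->
  reflection tau lam (coroot (reflection tau mu)) = lam (coroot mu).
Proof. by move=> mu0; rewrite !coroot_eval !reflection_df. Qed.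

Lemma coroot_reflection mu :
  coroot (reflection tau mu) = coroot mu - (tau (coroot mu) : K) *: coroot tau.
Proof.
rewrite {1}/coroot reflection_df [in LHS]reflectionE /nuinv linearB linearZ /=.
rewrite -!/(nuinv _) scalerBr -/(coroot mu); congr (_ - _).
rewrite /coroot !scalerA -!/(coroot _) !coroot_eval (df_sym tau mu); congr (_ *: _).
by ring.
Qed.

Lemma reflection_conj lam mu : df mu mu != 0 ->
  reflection (reflection tau mu) (reflection tau lam) = reflection tau (reflection mu lam).
Proof.
move=> mu0; rewrite [LHS]reflectionE reflection_coroot // (reflectionE lam mu).
by rewrite -scaleNr addrC -reflectionP addrC scaleNr.
Qed.

End Reflection.

End Form.

(* mathcomp's fingraph also exports a constant [roots]. *)
Local Notation roots := Defs.roots.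

(** * Real roots as Weyl translates of simple roots; integrality and inversions *)

Section RealRoots.
Variables (K : numClosedFieldType) (g : symKacMoody K).
Local Notation h := (cartan g).
Local Notation V := 'Hom(h, K^o).
Local Notation n := (km_n g).
Local Notation alpha := (@simple_root K g).
Local Notation alphav := (@simple_coroot K g).
Local Notation df := (@dual_form K g).
Local Notation Qp := (Qp alpha).
Implicit Types lam mu tau beta gam : V.
Let km := km_axioms g.

Lemma km_rho : exists om : 'I_n -> h, forall i j, alpha j (om i) = (i == j)%:R.
Proof. exact: km_om km. Qed.

Lemma root_sign lam : roots g lam -> Qp lam \/ Qp (- lam).
Proof. by move=> [_ [x wx x0]]; apply: (root_Qp km wx x0). Qed.

Lemma Qp_anti lam : Qp lam -> Qp (- lam) -> lam = 0.
Proof.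
have [om hom] := km_rho.
move=> [k hk] [k' hk']; rewrite hk big1 // => i _.
have := Qp_eval i hom hk'; rewrite opp_lfunE (Qp_eval i hom hk) => /eqP.
by rewrite eq_sym -addr_eq0 -natrD pnatr_eq0 addn_eq0 => /andP [_ /eqP ->].
Qed.

Definition ht_vec (om : 'I_n -> h) : h := \sum_i om i.

Lemma ht_sum om (k : 'I_n -> nat) : (forall i j, alpha j (om i) = (i == j)%:R) ->
  (\sum_i alpha i *+ k i) (ht_vec om) = (\sum_i k i)%:R.
Proof.
move=> hom; rewrite linear_sum natr_sum; apply: eq_bigr => i _.
exact: (Qp_eval i hom (erefl _)).
Qed.

Lemma simple_df_neq0 i : df (alpha i) (alpha i) != 0.
Proof.
by rewrite simple_norm mulf_neq0 ?pnatr_eq0 // invr_eq0 gt_eqF ?eps_gt0.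
Qed.

Lemma simple_reflectionE i lam :
  reflection (alpha i) lam = lam - (lam (alphav i) : K) *: alpha i.
Proof. by rewrite reflectionE coroot_simple. Qed.

Definition has_triple tau :=
  exists e f, root_triple (cartan_inj g) tau (coroot tau) e f.

Lemma has_triple_simple i : has_triple (alpha i).
Proof.
exists (chevalley_e (s := g) i), (chevalley_f (s := g) i).
by rewrite coroot_simple; exact: simple_root_triple km i.
Qed.

Lemma has_triple_reflection tau mu : df tau tau != 0 ->
  has_triple tau -> has_triple mu -> has_triple (reflection tau mu).
Proof.
move=> t0 [e [f ef]] [e' [f' ef']].
exists (refl_auto e f e'), (refl_auto e f f').
rewrite coroot_reflection // reflectionE.
exact: root_triple_refl ef ef'.
Qed.

Lemma root_reflection tau lam : df tau tau != 0 -> has_triple tau ->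
  roots g lam -> roots g (reflection tau lam).
Proof.
move=> t0 [e [f ef]] [l0 [x wx x0]]; split.
  apply: contra_neq l0 => l0; rewrite -(reflectionK t0 lam) l0.
  by rewrite reflectionE lfunE scale0r subr0.
exists (refl_auto e f x).
  by rewrite reflectionE; exact: (refl_auto_wsp ef wx).
apply: contra_neq x0 => x0; rewrite -(refl_autoNK ef x) x0.
by have := refl_autoZ (root_tripleN ef) 0 0; rewrite !scale0r.
Qed.

Definition word (ws : seq 'I_n) lam := foldr (fun i => reflection (alpha i)) lam ws.

Lemma word_cat ws ws' lam : word (ws ++ ws') lam = word ws (word ws' lam).
Proof. by rewrite /word foldr_cat. Qed.

Lemma wordK ws lam : word (rev ws) (word ws lam) = lam.
Proof.
elim: ws lam => // i ws IH lam; rewrite rev_cons -cats1 word_cat /=.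
by rewrite reflectionK ?simple_df_neq0.
Qed.

Lemma wordVK ws lam : word ws (word (rev ws) lam) = lam.
Proof. by rewrite -{1}[ws]revK wordK. Qed.

Lemma word_df ws lam mu : df (word ws lam) (word ws mu) = df lam mu.
Proof. by elim: ws => //= i ws IH; rewrite reflection_df ?simple_df_neq0. Qed.

Lemma word_root ws lam : roots g lam -> roots g (word ws lam).
Proof.
move=> rl; elim: ws => //= i ws IH.
by apply: root_reflection; [apply: simple_df_neq0|apply: has_triple_simple|].
Qed.

Lemma word_linear ws a lam mu : word ws (a *: lam + mu) = a *: word ws lam + word ws mu.
Proof. by elim: ws => //= i ws ->; rewrite reflectionP. Qed.

Lemma wordZ ws a lam : word ws (a *: lam) = a *: word ws lam.
Proof.
have w0 : word ws 0 = 0.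
  elim: ws => //= i ws ->; rewrite reflectionE lfunE /= scale0r subr0 //.
by have := word_linear ws a lam 0; rewrite w0 !addr0.
Qed.

Lemma has_triple_word ws i : has_triple (word ws (alpha i)).
Proof.
elim: ws => [|j ws IH] /=; first exact: has_triple_simple.
by apply: has_triple_reflection; [apply: simple_df_neq0|apply: has_triple_simple|].
Qed.

Lemma reflection_word ws mu lam : df mu mu != 0 ->
  reflection (word ws mu) (word ws lam) = word ws (reflection mu lam).
Proof.
move=> m0; elim: ws => //= i ws IH.
by rewrite reflection_conj ?IH ?word_df ?simple_df_neq0.
Qed.

(** The boolean [b] encodes a sign, here and in the descents below, so that positive and negative
    roots share one argument. *)
Lemma simple_multiple_root i m (b : bool) :
  roots g ((-1) ^+ b *: (alpha i *+ m)) -> m = 1%N.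
Proof.
move=> [l0 [x wx x0]]; apply/eqP; rewrite eqn_leq lt0n; apply/andP; split.
  case: b wx {l0} => wx; last by move: wx; rewrite scale1r => wx; exact: (simple_mulrn_root km wx x0).
  by move: wx; rewrite scaleN1r => wx; exact: (simple_mulrn_rootN km wx x0).
by apply: contra_neq l0 => ->; rewrite mulr0n scaler0.
Qed.

(* Only the i-th coefficient of beta changes, so the others are both >= 0 and <= 0. *)
Lemma simple_of_sign_change i c (b : bool) beta : roots g beta ->
  Qp ((-1) ^+ b *: beta) -> Qp (- ((-1) ^+ b *: (beta - c *: alpha i))) ->
  (-1) ^+ b *: beta = alpha i.
Proof.
have [om hom] := km_rho.
move=> rb [k hk] [k' hk'].
have k0 j : j != i -> k j = 0%N.
  move=> ji; have := Qp_eval j hom hk'.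
  rewrite opp_lfunE scalerBr scalerA add_lfunE opp_lfunE.
  rewrite [X in _ - X]scale_lfunE hom (negbTE ji) scaler0 subr0.
  rewrite (Qp_eval j hom hk) => /eqP; rewrite eq_sym -addr_eq0.
  by rewrite -natrD pnatr_eq0 addn_eq0 => /andP [_ /eqP].
have eb : (-1) ^+ b *: beta = alpha i *+ k i.
  rewrite hk (bigD1 i) //= big1 ?addr0 // => j /k0 ->; exact: mulr0n.
rewrite eb; suff -> : k i = 1%N by [].
apply: (@simple_multiple_root i (k i) b).
by rewrite -eb scalerA -expr2 sqrr_sign scale1r.
Qed.

Lemma reflection_simple_pos i beta : roots g beta -> Qp beta ->
  ~ Qp (reflection (alpha i) beta) -> beta = alpha i.
Proof.
move=> rb pb npb.
have rr := root_reflection (simple_df_neq0 i) (has_triple_simple i) rb.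
case: (root_sign rr) => // nr.
rewrite -[beta]scale1r -(expr0 (-1)); apply: (@simple_of_sign_change i (beta (alphav i)) false) => //.
  by rewrite scale1r.
by rewrite scale1r -simple_reflectionE.
Qed.

Lemma Q_int_pairing lam i : Qp lam \/ Qp (- lam) ->
  exists z : int, (lam (alphav i) : K) = z%:~R.
Proof.
have [_ _ ha _] := km_realization km.
have P mu : Qp mu -> exists z : int, (mu (alphav i) : K) = z%:~R.
  move=> [k ->]; exists (\sum_j km_A g i j *+ k j).
  rewrite sum_lfunE rmorph_sum; apply: eq_bigr => j _.
  by rewrite lfun_mulrnE ha /= -rmorphMn.
case=> [/P //|/P [z hz]]; exists (- z).
by rewrite rmorphN /= -hz opp_lfunE opprK.
Qed.

(** Up to sign beta = sum k_i alpha_i, and (beta, beta) = sum k_i (beta, alpha_i) > 0 makes some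
    pairing with k_i > 0 positive. Then s_i lowers the height, unless it changes the sign of beta,
    which forces beta = alpha_i up to sign. *)
Lemma real_root_word beta : real_roots g beta -> exists ws i, beta = word ws (alpha i).
Proof.
have [om hom] := km_rho.
suff H : forall N (b : bool) beta1, real_roots g beta1 -> (exists k : 'I_n -> nat,
    (-1) ^+ b *: beta1 = \sum_i alpha i *+ k i /\ (\sum_i k i < N)%N) ->
    exists ws i, beta1 = word ws (alpha i).
  move=> rb; case: (root_sign rb.1) => [] [k hk].
    by apply: (H _ false _ rb); exists k; split; [rewrite scale1r|apply: ltnSn].
  by apply: (H _ true _ rb); exists k; split; [rewrite scaleN1r|apply: ltnSn].
elim=> [|N IH] b {}beta [rb nb] [k [hk kN]] //.
set s := (-1) ^+ b : K in hk.
have ss : s * s = 1 by rewrite -expr2 sqrr_sign.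
have dfs : df beta beta = \sum_i (k i)%:R * df (s *: beta) (alpha i).
  have -> : df beta beta = df (s *: beta) (s *: beta).
    by rewrite dfZl dfZr mulrA ss mul1r.
  rewrite {2}hk df_sym dfE sum_lfunE; apply: eq_bigr => i _.
  by rewrite lfun_mulrnE -dfE df_sym mulr_natl.
have [i [ki di]] : exists i, (0 < k i)%N /\ 0 < ((s *: beta) (alphav i) : K).
  apply: contrapT => /forallNP H; move: nb; rewrite dfs le_gtF //.
  apply: sumr_le0 => i _; have := H i.
  case: (posnP (k i)) => [-> _|ki nH]; first by rewrite mul0r.
  rewrite mulr_ge0_le0 ?ler0n // df_simple mulr_le0_ge0 //; last by rewrite invr_ge0 ltW // eps_gt0.
  (* The order of [K] is partial: it is integrality that makes the pairing comparable with 0. *)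
  have [z hz] : exists z : int, ((s *: beta) (alphav i) : K) = z%:~R.
    by apply: Q_int_pairing; left; exists k.
  rewrite hz lerz0 leNgt; apply/negP => z0; apply: nH; split=> //.
  by rewrite hz ltr0z.
pose gam := reflection (alpha i) beta.
have rg : roots g gam := root_reflection (simple_df_neq0 i) (has_triple_simple i) rb.
have sg : s *: gam = s *: beta - ((s *: beta) (alphav i) : K) *: alpha i.
  by rewrite /gam simple_reflectionE scalerBr scalerA scale_lfunE.
have realg : real_roots g gam.
  by split=> //; rewrite reflection_df ?simple_df_neq0.
have back : beta = reflection (alpha i) gam by rewrite reflectionK ?simple_df_neq0.
have [[k' hk']|ng] : Qp (s *: gam) \/ Qp (- (s *: gam)).
  rewrite /s; case: (b); rewrite ?expr1 ?expr0 ?scaleN1r ?scale1r ?opprK.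
    by case: (root_sign rg); [right|left].
  exact: root_sign.
- have [ws [j gw]] : exists ws j, gam = word ws (alpha j).
    apply: (IH b) => //; exists k'; split=> //.
    suff lt : (\sum_i k' i < \sum_i k i)%N by apply: leq_trans lt _; rewrite -ltnS.
    rewrite -(ltr_nat K) -!(ht_sum _ hom) -hk' -hk sg add_lfunE opp_lfunE gtrBl.
    move: di; set c := (s *: beta) (alphav i) => di.
    rewrite scale_lfunE /ht_vec linear_sum (bigD1 i) //= hom eqxx big1 ?addr0 ?scaler1.
      by rewrite /GRing.scale /= mulr1.
    by move=> j ji; rewrite hom (negbTE ji).
  by exists (i :: ws), j; rewrite /= -gw.
have eb : s *: beta = alpha i.
  apply: (@simple_of_sign_change i (beta (alphav i)) b _ rb); first by exists k.
  by rewrite -simple_reflectionE.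
have eb' : beta = s *: alpha i by rewrite -eb scalerA ss scale1r.
move: eb'; rewrite /s; case: (b) => [->|->].
  by exists [:: i], i; rewrite /= reflection_self ?simple_df_neq0 // scaleN1r.
by exists [::], i; rewrite scale1r.
Qed.

Lemma real_df_neq0 tau : real_roots g tau -> df tau tau != 0.
Proof. by move=> [_ /gt_eqF ->]. Qed.

Lemma real_has_triple tau : real_roots g tau -> has_triple tau.
Proof. by move=> /real_root_word [ws [i ->]]; apply: has_triple_word. Qed.

Lemma real_root_reflection tau lam : real_roots g tau -> roots g lam ->
  roots g (reflection tau lam).
Proof.
by move=> rt; apply: root_reflection; [apply: real_df_neq0|apply: real_has_triple].
Qed.

Lemma real_reflection_real tau lam : real_roots g tau -> real_roots g lam ->
  real_roots g (reflection tau lam).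
Proof.
move=> rt [rl pl]; split; first exact: real_root_reflection.
by rewrite reflection_df // real_df_neq0.
Qed.

Lemma real_rootN lam : real_roots g lam -> real_roots g (- lam).
Proof.
by move=> rl; rewrite -reflection_self ?real_df_neq0 //; apply: real_reflection_real.
Qed.

(** A word moves [tau] to a simple root, whose coroot takes integral values on the root lattice. *)
Lemma real_pairing_int lam tau : real_roots g tau -> roots g lam ->
  exists z : int, (lam (coroot tau) : K) = z%:~R.
Proof.
move=> rt rl; have [ws [i tw]] := real_root_word rt.
have [z hz] := Q_int_pairing i (root_sign (word_root (rev ws) rl)).
exists z; rewrite -hz -[in RHS]coroot_simple !coroot_eval tw word_df.
by rewrite -[in LHS](wordVK ws lam) word_df.
Qed.

Lemma real_multiple lam tau c : real_roots g tau -> real_roots g lam ->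
  lam = c *: tau -> lam = tau \/ lam = - tau.
Proof.
have [om hom] := km_rho.
move=> rt [rl _] e; have [ws [i tw]] := real_root_word rt.
have el : word (rev ws) lam = c *: alpha i by rewrite e wordZ tw wordK.
have rl' := word_root (rev ws) rl; rewrite el in rl'.
have [b [m cm]] : exists (b : bool) m, c = (-1) ^+ b * m%:R.
  case: (root_sign rl') => [] [k hk].
    exists false, (k i); have := Qp_eval i hom hk.
    by rewrite scale_lfunE hom eqxx /GRing.scale /= mulr1 mul1r.
  exists true, (k i); have := Qp_eval i hom hk.
  rewrite opp_lfunE scale_lfunE hom eqxx /GRing.scale /= mulr1 mulN1r => <-.
  by rewrite opprK.
have m1 : m = 1%N.
  apply: (@simple_multiple_root i m b); move: rl'.
  by rewrite cm -scalerA scaler_nat.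
by rewrite e cm m1 mulr1; case: (b); [right; rewrite scaleN1r|left; rewrite scale1r].
Qed.

(** Each letter [i] adds at most one inversion: a root that [ws] leaves positive and s_i then makes
    negative is sent by [ws] to [alpha i]. *)
Lemma word_inversions ws : exists l : seq V, forall beta,
  roots g beta -> Qp beta -> Qp (- word ws beta) -> beta \in l.
Proof.
elim: ws => [|i ws [l hl]].
  by exists [::] => beta [b0 _] pb nb; case/eqP: b0; apply: Qp_anti.
exists (word (rev ws) (alpha i) :: l) => beta rb pb /= nb; rewrite inE.
have rw := word_root ws rb.
case: (root_sign rw) => [pw|nw]; last by rewrite (hl _ rb pb nw) orbT.
have -> : beta = word (rev ws) (alpha i); last by rewrite eqxx.
rewrite -(reflection_simple_pos rw pw (i := i)) ?wordK // => pr.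
have [r0 _] := root_reflection (simple_df_neq0 i) (has_triple_simple i) rw.
by case/eqP: r0; apply: Qp_anti.
Qed.

Lemma reflection_inversions gam : real_roots g gam -> exists l : seq V, forall beta,
  roots g beta -> Qp beta -> Qp (- reflection gam beta) -> beta \in l.
Proof.
move=> /real_root_word [ws [i ->]].
have [l hl] := word_inversions (ws ++ i :: rev ws).
exists l => beta rb pb nb; apply: hl => //.
by rewrite word_cat /= -reflection_word ?simple_df_neq0 // wordVK.
Qed.

End RealRoots.

(** * Heights, positive roots of a subroot system, and its minimal elements *)

Section Combinatorics.
Variables (K : numClosedFieldType) (g : symKacMoody K).
Local Notation h := (cartan g).
Local Notation V := 'Hom(h, K^o).
Local Notation n := (km_n g).
Local Notation alpha := (@simple_root K g).
Local Notation df := (@dual_form K g).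
Local Notation Qp := (Qp alpha).
Implicit Types (lam mu tau beta gam sigma : V) (Psi S : set V) (t : seq V).
Let km := km_axioms g.

Definition fund_vec : 'I_n -> h := projT1 (cid (km_rho g)).
Local Notation om := fund_vec.

Lemma fund_vecE i j : alpha j (om i) = (i == j)%:R.
Proof. by rewrite /om; case: cid. Qed.

Definition rho : h := ht_vec om.

(** Evaluation at [rho] adds up the coefficients, but with values in [K]; [xget] extracts the
    natural number, with default 0 when there is none. *)
Definition ht lam : nat := xget 0%N [set N : nat | (lam rho : K) = N%:R].

Lemma htE lam : Qp lam -> (lam rho : K) = (ht lam)%:R.
Proof.
move=> [k hk]; rewrite /ht; case: xgetP => [N _ //|/(_ (\sum_i k i)%N)].
by rewrite /= hk ht_sum //; exact: fund_vecE.
Qed.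

Lemma Qp_ht0 lam : Qp lam -> ht lam = 0%N -> lam = 0.
Proof.
move=> pl; have := htE pl; case: pl => k hk; rewrite [in LHS]hk (ht_sum _ fund_vecE) => /eqP.
rewrite eqr_nat => /eqP <- /eqP; rewrite sum_nat_eq0 => /forallP k0.
by rewrite hk big1 // => i _; move: (k0 i) => /eqP ->.
Qed.

Lemma htD lam mu : Qp lam -> Qp mu -> ht (lam + mu) = (ht lam + ht mu)%N.
Proof.
move=> pl pm; apply/eqP; rewrite -(eqr_nat K) -htE ?natrD; last exact: QpD.
by rewrite add_lfunE !htE.
Qed.

Lemma QpMn lam m : Qp lam -> Qp (lam *+ m).
Proof.
move=> pl; elim: m => [|m IH]; first exact: Qp0.
by rewrite mulrS; apply: QpD.
Qed.

Lemma htMn lam m : Qp lam -> ht (lam *+ m) = (ht lam * m)%N.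
Proof.
move=> pl; apply/eqP; rewrite -(eqr_nat K) -htE; last exact: QpMn.
by rewrite lfun_mulrnE htE // natrM mulr_natr.
Qed.

Lemma pos_ht_gt0 lam : pos_roots g lam -> (0 < ht lam)%N.
Proof.
move=> [[l0 _] pl]; rewrite lt0n; apply: contra_neq l0; exact: Qp_ht0.
Qed.

Lemma pos_not_neg lam : roots g lam -> Qp lam -> ~ Qp (- lam).
Proof. by move=> [/eqP l0 _] p q; apply: l0; apply: Qp_anti. Qed.

Lemma Qp_coords lam : Qp lam -> lam = \sum_j (lam (om j) : K) *: alpha j.
Proof.
move=> [k hk]; rewrite [LHS]hk; apply: eq_bigr => j _.
by rewrite (Qp_eval j fund_vecE hk) scaler_nat.
Qed.

Lemma pairing_pos lam tau : real_roots g tau -> roots g lam ->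
  0 < df lam tau -> exists p : nat, (lam (coroot tau) : K) = p.+1%:R.
Proof.
move=> rt rl dp; have [z hz] := real_pairing_int rt rl.
have : 0 < (lam (coroot tau) : K).
  by rewrite coroot_eval divr_gt0 ?mulr_gt0 //; case: rt.
rewrite hz ltr0z; by case: z hz => [[|p]|m] hz // _; exists p.
Qed.

(** Up to the positive factor (tau, tau)/2 the value is an integer, and integers are totally ordered
    although [K] is not. *)
Lemma pairing_nonpos lam tau : real_roots g tau -> roots g lam ->
  ~ 0 < df lam tau -> df lam tau <= 0.
Proof.
move=> rt rl dp; have [z hz] := real_pairing_int rt rl.
have e : df lam tau = z%:~R * (df tau tau / 2).
  rewrite -hz coroot_eval; have := real_df_neq0 rt => t0; field; rewrite t0 //.
have t2 : 0 < df tau tau / 2 by rewrite divr_gt0 //; case: rt.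
rewrite e pmulr_lle0 // lerz0 leNgt; apply/negP => z0; apply: dp.
by rewrite e pmulr_lgt0 // ltr0z.
Qed.

Lemma reflectionN tau lam : reflection (- tau) lam = reflection tau lam.
Proof.
rewrite /reflection -[- tau]scaleN1r dfZl !dfZr scalerA; congr (_ - _ *: _).
have [->|t0] := eqVneq (df tau tau) 0; first by rewrite !mulr0 invr0 !mulr0 mul0r.
by field.
Qed.

Lemma reflectionrN tau lam : reflection tau (- lam) = - reflection tau lam.
Proof. by rewrite !reflectionE opp_lfunE scaleNr opprD. Qed.

Lemma reflectionrZ tau a lam : reflection tau (a *: lam) = a *: reflection tau lam.
Proof. by rewrite !reflectionE scale_lfunE scalerBr scalerA. Qed.

Definition subroot_system Psi :=
  Psi `<=` real_roots g /\
  forall tau lam, Psi tau -> Psi lam -> Psi (reflection tau lam).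

Section Subroot.
Variable Psi : set V.
Hypothesis hPsi : subroot_system Psi.
Local Notation Omega := (Psi `&` pos_roots g).

Lemma Psi_real lam : Psi lam -> real_roots g lam.
Proof. by case: hPsi => h1 _; apply: h1. Qed.

Lemma Psi_root lam : Psi lam -> roots g lam.
Proof. by move=> /Psi_real []. Qed.

Lemma PsiN lam : Psi lam -> Psi (- lam).
Proof.
move=> pl; rewrite -reflection_self; last exact: real_df_neq0 (Psi_real pl).
by case: hPsi => _; apply.
Qed.

Lemma Omega_reflection tau lam : Psi tau -> Psi lam ->
  Qp (reflection tau lam) -> Omega (reflection tau lam).
Proof.
move=> pt pl q; have pr : Psi (reflection tau lam) by case: hPsi => _; apply.
by split=> //; split=> //; exact: Psi_root.
Qed.

Lemma OmegaN_reflection tau lam : Psi tau -> Psi lam ->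
  Qp (- reflection tau lam) -> Omega (- reflection tau lam).
Proof.
move=> pt pl q; have pr : Psi (- reflection tau lam).
  by apply: PsiN; case: hPsi => _; apply.
by split=> //; split=> //; exact: Psi_root.
Qed.

Lemma not_Qp_reflection tau lam : Psi tau -> Psi lam ->
  ~ Qp (reflection tau lam) -> Qp (- reflection tau lam).
Proof.
move=> pt pl nq; have pr : Psi (reflection tau lam) by case: hPsi => _; apply.
by case: (root_sign (Psi_root pr)).
Qed.

Lemma Omega_collinear tau gam c : Omega tau -> Omega gam -> tau = c *: gam -> tau = gam.
Proof.
move=> [pt [rt qt]] [pg [rg qg]] e.
case: (real_multiple (Psi_real pg) (Psi_real pt) e) => // e'.
by case: (pos_not_neg rg qg); rewrite -e'.
Qed.

(** Let c be the value of tau on the coroot of gam. The height of c gam - tau is nonnegative, so c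
    ht(gam) >= ht(tau) > 0. *)
Lemma inverted_pairing tau gam : Omega tau -> Omega gam -> Qp (- reflection gam tau) ->
  0 < df gam tau.
Proof.
move=> [pt [rt qt]] [pg [rg qg]] ng.
have [z hz] := real_pairing_int (Psi_real pg) rt.
have gp : 0 < (gam rho : K) by rewrite htE // ltr0n pos_ht_gt0.
have tp : 0 < (tau rho : K) by rewrite htE // ltr0n pos_ht_gt0.
have : 0 <= ((- reflection gam tau) rho : K) by rewrite htE // ler0n.
rewrite reflectionE opprB add_lfunE opp_lfunE scale_lfunE subr_ge0 => le.
have : 0 < (tau (coroot gam) : K) * gam rho := lt_le_trans tp le.
rewrite pmulr_lgt0 // coroot_eval df_sym => c0.
have g0 : 0 < df gam gam by case: (Psi_real pg).
have -> : df gam tau = 2 * df gam tau / df gam gam * (df gam gam / 2).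
  by field; rewrite gt_eqF.
by rewrite mulr_gt0 // divr_gt0.
Qed.

Lemma reflection_descent tau gam : Omega tau -> Omega gam ->
  0 < df gam tau -> Qp (reflection tau gam) ->
  (ht tau < ht gam)%N /\ (ht (reflection tau gam) < ht gam)%N.
Proof.
move=> ot og dp qr.
have [p hp] := pairing_pos (Psi_real ot.1) og.2.1 dp.
have e : gam = reflection tau gam + tau *+ p.+1.
  by rewrite reflectionE hp scaler_nat addrNK.
have [_ [_ qt]] := ot.
have e2 : ht gam = (ht (reflection tau gam) + ht tau * p.+1)%N.
  by rewrite [in LHS]e htD // ?htMn //; exact: QpMn.
have t0 := pos_ht_gt0 ot.2.
have r0 := pos_ht_gt0 (Omega_reflection ot.1 og.1 qr).2.
by rewrite e2; split; nia.
Qed.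

(* If every positive reflection of gam raises its height, then the set T of
   positive roots inverted by s_gam, other than gam, is stable under
   tau |-> - s_tau gam = p tau - gam, which multiplies by p the functional
   [wedge], vanishing on gam; since p = 1 lowers the height, wedge is unbounded
   on T, while T is finite. *)
Section Terminal.
Variable gam : V.
Hypothesis og : Omega gam.
Hypothesis term : forall tau, Omega tau -> tau != gam -> 0 < df gam tau ->
  ~ Qp (reflection tau gam).

Definition inverted : set V :=
  [set tau | [/\ Omega tau, tau != gam & Qp (- reflection gam tau)]].

Lemma inverted_reflection tau : inverted tau -> inverted (- reflection gam tau).
Proof.
move=> [ot tg q]; have g0 := real_df_neq0 (Psi_real og.1); split.
- exact: OmegaN_reflection og.1 ot.1 q.
- apply: contra_neq tg => e; rewrite -(reflectionK g0 tau) -[reflection gam tau]opprK e.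
  by rewrite reflectionrN reflection_self ?opprK.
- by rewrite reflectionrN reflectionK // opprK; case: ot => _ [].
Qed.

Lemma inverted_neg_reflection tau : inverted tau -> Qp (- reflection tau gam).
Proof.
move=> [ot tg q]; apply: not_Qp_reflection; [exact: ot.1|exact: og.1|].
by apply: term => //; apply: inverted_pairing.
Qed.

Lemma inverted_step tau : inverted tau -> inverted (- reflection tau gam).
Proof.
move=> it; have [ot tg q] := it.
have g0 := real_df_neq0 (Psi_real og.1); have t0 := real_df_neq0 (Psi_real ot.1).
have qn := inverted_neg_reflection it.
have on := OmegaN_reflection ot.1 og.1 qn.
split=> //.
  apply/eqP => e; case/eqP: tg; apply/esym.
  apply: (@Omega_collinear _ _ (2^-1 * (gam (coroot tau) : K))) => //.
  have e2 : gam + gam = (gam (coroot tau) : K) *: tau.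
    by rewrite -{1}e reflectionE opprB addrNK.
  by rewrite -scalerA -e2 -mulr2n -scaler_nat scalerA mulVf ?scale1r // pnatr_eq0.
(* By conjugation, that s_gam inverts the new root amounts to [inverted_neg_reflection] for
   -s_gam(tau) in place of [tau]. *)
have e : reflection (- reflection gam tau) gam = - reflection gam (reflection tau gam).
  rewrite reflectionN -(reflection_conj g0 gam t0) reflection_self //.
  by rewrite reflectionrN opprK.
have := inverted_neg_reflection (inverted_reflection it).
by rewrite e reflectionrN.
Qed.

(** A coordinate of the exterior product of [gam] and [x]; these minors all vanish only if the two
    coordinate vectors are proportional. *)
Definition wedge i j (x : V) : K :=
  (gam (om i) : K) * x (om j) - (gam (om j) : K) * x (om i).

Definition absw i j (x : V) : nat := xget 0%N [set N : nat | `|wedge i j x| = N%:R].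

Lemma abswE i j x : Qp x -> `|wedge i j x| = (absw i j x)%:R.
Proof.
move=> [k hk]; have [_ [_ [k' hk']]] := og.
rewrite /absw; case: xgetP => [N _ //|].
move=> /(_ (absz ((k' i * k j)%:Z - (k' j * k i)%:Z))) []; rewrite /=.
rewrite /wedge !(Qp_eval _ fund_vecE hk) !(Qp_eval _ fund_vecE hk') -!natrM.
by rewrite natr_absz intr_norm rmorphB.
Qed.

Lemma wedge_step i j tau : wedge i j (- reflection tau gam) =
  (gam (coroot tau) : K) * wedge i j tau.
Proof.
rewrite /wedge reflectionE opprB !add_lfunE !opp_lfunE !scale_lfunE.
rewrite /GRing.scale /=.
move: (gam (coroot tau) : K) (gam (om i) : K) (gam (om j) : K) (tau (om i) : K) (tau (om j) : K).
by move=> a b c d e; ring.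
Qed.

Lemma absw_increase i j tau : inverted tau -> (0 < absw i j tau)%N ->
  exists2 tau', inverted tau' & (absw i j tau < absw i j tau')%N.
Proof.
have [N hN] := ubnP (ht tau); elim: N tau hN => // N IH tau hN it w0.
have [[pt [rt qt]] tg q] := it.
have is1 := inverted_step it.
have [[ps [rs qs]] _ _] := is1.
have dp : 0 < df gam tau by apply: inverted_pairing.
have [p hp] := pairing_pos (Psi_real pt) og.2.1 dp.
have e1 : absw i j (- reflection tau gam) = (p.+1 * absw i j tau)%N.
  apply/eqP; rewrite -(eqr_nat K) -abswE // wedge_step normrM hp natrM.
  by rewrite ger0_norm ?ler0n // abswE.
(* The pairing is p+1. From 2 on, [absw] at least doubles; when it is 1, [absw] is unchanged and tau
   = -s_tau(gam) + gam shows that the new root is lower. *)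
case: p hp e1 => [|p] hp e1; last first.
  by exists (- reflection tau gam) => //; rewrite e1; nia.
rewrite mul1n in e1.
have e2 : - reflection tau gam + gam = tau.
  by rewrite reflectionE hp scale1r opprB addrNK.
have lt : (ht (- reflection tau gam) < N)%N.
  have := htD qs og.2.2; rewrite e2 => e3.
  by have := pos_ht_gt0 og.2; move: hN; rewrite e3; lia.
have [|tau' it' lt'] := IH _ lt is1; first by rewrite e1.
by exists tau'; rewrite // -e1.
Qed.

Lemma inverted_empty tau : ~ inverted tau.
Proof.
move=> it; have [ot tg q] := it.
have [i gi] : exists i, (gam (om i) : K) != 0.
  apply: contrapT => /forallNP H; have [_ [[/eqP gn0 _] qg]] := og; apply: gn0.
  rewrite (Qp_coords qg) big1 // => i _.
  by have := H i => /negP; rewrite negbK => /eqP ->; rewrite scale0r.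
have [j wj] : exists j, wedge i j tau != 0.
  apply: contrapT => /forallNP H; case/eqP: tg.
  apply: (@Omega_collinear _ _ ((gam (om i) : K)^-1 * tau (om i))) => //.
  rewrite [LHS](Qp_coords ot.2.2) [in X in _ = _ *: X](Qp_coords og.2.2) scaler_sumr.
  apply: eq_bigr => j _; rewrite scalerA; congr (_ *: _).
  have := H j => /negP; rewrite negbK subr_eq0 => /eqP e.
  by apply: (mulfI gi); rewrite e !mulrA mulfV // mul1r mulrC.
have w0 : (0 < absw i j tau)%N.
  by rewrite -(ltr_nat K) -abswE ?normr_gt0 //; case: ot => _ [].
have [l hl] := reflection_inversions (Psi_real og.1).
have bound x : inverted x -> (absw i j x <= \sum_(y <- l) absw i j y)%N.
  move=> [[_ [rx qx]] _ nx]; have xl := hl _ rx qx nx.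
  by rewrite (big_rem x) //= leq_addr.
suff H N : exists2 x, inverted x & (N < absw i j x)%N.
  have [x ix] := H (\sum_(y <- l) absw i j y)%N.
  by rewrite ltnNge bound.
elim: N => [|N [x ix lx]]; first by exists tau.
have [y iy ly] := absw_increase ix (leq_ltn_trans (leq0n _) lx).
by exists y => //; apply: leq_ltn_trans ly.
Qed.

(** With no inversions left, s_gam keeps the rest of [Omega] positive. The functional x |-> ht(s_gam
    x), evaluation at [t] below, is thus nonnegative on the other elements of [Omega] and negative
    at [gam], so [gam] is not a nonnegative combination of them. *)
Lemma terminal_simple : simple_system Psi gam.
Proof.
split=> // gam1 o1 [a [s [c [a0 hs e]]]]; apply: contrapT => /eqP n1.
have pos x : Omega x -> x != gam -> 0 <= (reflection gam x rho : K).
  move=> ox xg; suff qx : Qp (reflection gam x) by rewrite htE.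
  apply: contrapT => nq; apply: (@inverted_empty x); split=> //.
  by apply: not_Qp_reflection => //; [exact: og.1|exact: ox.1].
pose t := rho - (gam rho : K) *: coroot gam.
have E x : (reflection gam x rho : K) = x t.
  rewrite reflectionE add_lfunE opp_lfunE scale_lfunE [RHS]linearB /= [X in _ = _ - X]linearZ /=.
  by rewrite /GRing.scale /= mulrC.
have gp : 0 < (gam rho : K) by rewrite htE ?ltr0n ?pos_ht_gt0 //; case: og => _ [].
have : (reflection gam gam rho : K) < 0.
  by rewrite reflection_self ?opp_lfunE ?oppr_lt0 //; apply: real_df_neq0 (Psi_real og.1).
rewrite E e add_lfunE scale_lfunE sum_lfunE le_gtF //.
apply: addr_ge0.
  by rewrite -E mulr_ge0 ?pos // ler0q ltW.
rewrite big_seq; apply: sumr_ge0 => x /hs [ox _ xg cx].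
by rewrite scale_lfunE -E mulr_ge0 ?pos // ler0q.
Qed.

End Terminal.

Lemma nonsimple_descent gam : Omega gam -> ~ simple_system Psi gam ->
  exists tau, [/\ Omega tau, Omega (reflection tau gam),
    (ht tau < ht gam)%N & (ht (reflection tau gam) < ht gam)%N].
Proof.
move=> og ns; apply: contrapT => H; apply: ns; apply: terminal_simple => //.
move=> tau ot tg dp q; apply: H; exists tau.
have [h1 h2] := reflection_descent ot og dp q.
by split=> //; apply: Omega_reflection => //; [exact: ot.1|exact: og.1].
Qed.

(** Cancel the c copies of [beta] occurring in [t]; heights give c < m. Dividing by m - c turns what
    remains into [root_preceq] between [sigma] and [beta], which minimality excludes. *)
Lemma simple_indecomposable beta m t sigma : simple_system Psi beta ->
  (forall x, x \in t -> Omega x) -> beta *+ m = \sum_(x <- t) x ->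
  sigma \in t -> sigma = beta.
Proof.
move=> [ob hb] ht e st; apply: contrapT => /eqP sb.
set c := count_mem beta t; set d := count_mem sigma t.
pose r := [seq x <- t | (x != beta) && (x != sigma)].
have cnt x : \sum_(y <- t | y == x) y = x *+ count_mem x t.
  rewrite -big_filter (eq_big_seq (fun=> x)); last first.
    by move=> y; rewrite mem_filter => /andP [/eqP].
  by rewrite big_const_seq count_predT size_filter iter_addr_0.
have e1 : beta *+ m = beta *+ c + (sigma *+ d + \sum_(x <- r) x).
  rewrite e (bigID (fun x => x == beta)) /= cnt; congr (_ + _).
  rewrite (bigID (fun x => x == sigma)) /= big_filter; congr (_ + _).
  rewrite -cnt; apply: eq_bigl => x; case: (x =P sigma) => [->|]; rewrite ?andbF //.
  by rewrite sb.
have d0 : (0 < d)%N by rewrite -has_count; apply/hasP; exists sigma => /=.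
have hpos x : Omega x -> 0 < (x rho : K).
  by move=> [_ px]; rewrite htE ?ltr0n ?pos_ht_gt0 //; case: px.
have cm : (c < m)%N.
  have e1r := congr1 (fun x : V => (x rho : K)) e1.
  rewrite /= !add_lfunE !lfun_mulrnE sum_lfunE in e1r.
  rewrite ltnNge; apply/negP => mc.
  have := ler_wpMn2l (ltW (hpos _ ob)) mc; rewrite e1r gerDl lt_geF //.
  rewrite ltr_pwDl // ?pmulrn_lgt0 //; first by apply: hpos; apply: ht.
  rewrite big_seq; apply: sumr_ge0 => x; rewrite mem_filter => /andP [_ /ht ox].
  by apply: ltW; apply: hpos.
have nz : (m - c)%:R != 0 :> K by rewrite pnatr_eq0 -lt0n subn_gt0.
have e2 : (m - c)%:R *: beta = sigma *+ d + \sum_(x <- r) x.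
  by rewrite scaler_nat mulrnBr ?(ltnW cm) // e1 addrAC subrr add0r.
case/eqP: sb; apply: hb; first exact: ht.
exists (d%:R / (m - c)%:R), r, (fun=> (m - c)%:R^-1); split.
- by rewrite divr_gt0 ?ltr0n // subn_gt0.
- move=> x; rewrite mem_filter => /andP [/andP [xb xs] /ht ox]; split=> //.
  by rewrite invr_ge0 ler0n.
rewrite -scaler_sumr fmorph_div fmorphV !rmorph_nat.
apply: (scalerI nz); rewrite e2 scalerDr !scalerA mulrCA divff // mulr1 scale1r.
by rewrite scaler_nat.
Qed.

(** Otherwise tau + (-s_beta tau), a sum of two elements of [Omega], would be a multiple of
    [beta]. *)
Lemma simple_reflection_pos beta tau : simple_system Psi beta -> Omega tau ->
  tau != beta -> Qp (reflection beta tau).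
Proof.
move=> sb ot tb; have ob := sb.1; apply: contrapT => nq.
have q := not_Qp_reflection ob.1 ot.1 nq.
have on := OmegaN_reflection ob.1 ot.1 q.
have dp := inverted_pairing ot ob q; rewrite df_sym in dp.
have [p hp] := pairing_pos (Psi_real ob.1) ot.2.1 dp.
case/eqP: tb; apply: (@simple_indecomposable beta p.+1 [:: tau; - reflection beta tau]) => //.
- by move=> x; rewrite !inE => /orP [] /eqP ->.
- by rewrite !big_cons big_nil addr0 reflectionE hp scaler_nat opprB addrC addrNK.
- by rewrite mem_head.
Qed.

(** If (a, b) > 0, both s_b(a) and s_a(b) are positive, and the descent gives ht b < ht a as well as
    ht a < ht b. *)
Lemma simple_obtuse a b : simple_system Psi a -> simple_system Psi b -> a != b ->
  df a b <= 0.
Proof.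
move=> sa sb ab; have oa := sa.1; have ob := sb.1.
apply: pairing_nonpos; [exact: Psi_real ob.1|exact: oa.2.1|move=> dp].
have [h1 _] := reflection_descent ob oa dp (simple_reflection_pos sb oa ab).
rewrite df_sym in dp; rewrite eq_sym in ab.
have [h2 _] := reflection_descent oa ob dp (simple_reflection_pos sa ob ab).
by move: (ltn_trans h1 h2); rewrite ltnn.
Qed.

Lemma simple_pi_system : (forall a b, Psi a -> Psi b -> real_roots g (a + b) -> Psi (a + b)) ->
  pi_system (simple_system Psi).
Proof.
move=> hcl; split; first by move=> a sa; exact: Psi_real sa.1.1.
move=> a b sa sb rab; have oa := sa.1; have ob := sb.1.
have ab : a != b by case: rab => + _; rewrite subr_eq0.
have pab : Psi (a - b).
  apply: hcl; [exact: oa.1|exact: PsiN ob.1|split=> //].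
  rewrite -[- b]scaleN1r !(dfDl, dfDr, dfZl, dfZr) (df_sym b a).
  have [_ pa] := Psi_real oa.1; have [_ pb] := Psi_real ob.1.
  have le := simple_obtuse sa sb ab.
  have -> : df a a + -1 * df a b + (-1 * df a b + -1 * (-1 * df b b)) =
    df a a + df b b + 2 * - df a b by ring.
  by apply: ltr_wpDr; [rewrite mulr_ge0 ?oppr_ge0|rewrite addr_gt0].
case: (root_sign rab) => q.
- have oab : Omega (a - b) by split.
  case/eqP: ab; apply/esym; apply: (@simple_indecomposable a 1 [:: b; a - b]) => //.
  + by move=> x; rewrite !inE => /orP [] /eqP ->.
  + by rewrite !big_cons big_nil addr0 addrC addrNK.
  + by rewrite mem_head.
- have oba : Omega (b - a).
    rewrite -opprB; have := PsiN pab => p; split=> //; split=> //; exact: Psi_root.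
  case/eqP: ab; apply: (@simple_indecomposable b 1 [:: a; b - a]) => //.
  + by move=> x; rewrite !inE => /orP [] /eqP ->.
  + by rewrite !big_cons big_nil addr0 addrC addrNK.
  + by rewrite mem_head.
Qed.

End Subroot.

End Combinatorics.

(** * Nonnegative integral spans as sums of lists *)

Section ListSpan.
Variables (W : zmodType) (S : set W).

(** Lists with repetition add by concatenation; the coefficients in [Zplus_span] are recovered as
    multiplicities. *)
Definition list_span : set W :=
  [set lam | exists t : seq W, (forall x, x \in t -> S x) /\ lam = \sum_(x <- t) x].

Lemma list_spanD lam mu : list_span lam -> list_span mu -> list_span (lam + mu).
Proof.
move=> [t [ht ->]] [t' [ht' ->]]; exists (t ++ t'); rewrite big_cat; split=> // x.
by rewrite mem_cat => /orP [/ht|/ht'].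
Qed.

Lemma list_span_sub lam : S lam -> list_span lam.
Proof.
move=> Sl; exists [:: lam]; rewrite big_seq1; split=> // x.
by rewrite inE => /eqP ->.
Qed.

Lemma list_span0 : list_span 0.
Proof. by exists [::]; rewrite big_nil. Qed.

Lemma sum_undup (t : seq W) : \sum_(x <- t) x = \sum_(x <- undup t) x *+ count_mem x t.
Proof.
rewrite -big_undup_iterop_count; apply: eq_bigr => x _.
by elim: (count_mem x t) => // m IH; rewrite mulrS iteropS -IH; case: (m); rewrite ?mulr0n ?addr0.
Qed.

Lemma list_span_Zplus lam : list_span lam -> Zplus_span S lam.
Proof.
move=> [t [ht ->]]; exists (undup t), (fun x => count_mem x t).
by split=> [x|]; [rewrite mem_undup; apply: ht|apply: sum_undup].
Qed.

Lemma list_span_Zminus lam : list_span (- lam) -> Zminus_span S lam.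
Proof.
move=> [t [ht e]]; exists (undup t), (fun x => count_mem x t).
split=> [x|]; first by rewrite mem_undup; apply: ht.
by rewrite sumrN -sum_undup -e opprK.
Qed.

End ListSpan.

(** * The subalgebras g(Psi) and g(Sigma) and their weights *)

Section Generation.
Variables (K : numClosedFieldType) (g : symKacMoody K).
Local Notation h := (cartan g).
Local Notation V := 'Hom(h, K^o).
Local Notation alpha := (@simple_root K g).
Local Notation df := (@dual_form K g).
Local Notation Qp := (Qp alpha).
Local Notation rsp := (@root_space K g).
Implicit Types (lam mu tau beta gam sigma : V) (Psi S Sigma : set V).
Let km := km_axioms g.

Lemma root_gen_sub S lam : S lam \/ S (- lam) -> rsp lam `<=` root_gen S.
Proof.
move=> hl x wx; apply: sub_lie_gen; exists lam => //.
by case: hl => [Sl|Sl]; [left|right; exists (- lam) => //; rewrite opprK].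
Qed.

Lemma root_gen_min S (U : set (km_alg g)) : lie_subalgebra U ->
  (forall lam, S lam -> rsp lam `<=` U /\ rsp (- lam) `<=` U) -> root_gen S `<=` U.
Proof.
move=> hU hS; apply: lie_gen_min => // x [lam [Sl|[mu Sm <-]] wx].
  by case: (hS _ Sl) => + _; apply.
by case: (hS _ Sm) => _; apply.
Qed.

(** The triple of [tau] lies in [U], so the automorphism preserves [U]; its inverse comes from the
    opposite triple, which has the same reflection. *)
Lemma reflection_auto_sub (U : set (km_alg g)) tau : lie_subalgebra U ->
  real_roots g tau -> rsp tau `<=` U -> rsp (- tau) `<=` U ->
  exists r r' : km_alg g -> km_alg g,
    [/\ cancel r r', cancel r' r, r 0 = 0, forall x, U x -> U (r x) &
      forall mu x, rsp mu x -> rsp (reflection tau mu) (r x) /\ rsp (reflection tau mu) (r' x)].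
Proof.
move=> [hU hUl] rt ut unt; have [e [f ef]] := real_has_triple rt.
have efN := root_tripleN ef.
exists (refl_auto e f), (refl_auto (- e) (- f)); split.
- exact: refl_autoNK ef.
- exact: refl_autoK ef.
- by have := refl_autoZ ef 0 0; rewrite !scale0r.
- have [[we wf _ _] _] := ef.
  apply: refl_auto_stable => // y Uy; apply: hUl => //; [exact: ut|exact: unt].
- move=> mu x wx; rewrite reflectionE; split.
    exact: (refl_auto_wsp ef wx).
  exact: (refl_auto_wsp efN wx).
Qed.

(** Write x = r (r' x): the inverse moves [x] into the weight space of s_tau(gam), hence into [U],
    and r preserves [U]. *)
Lemma rsp_reflection_sub (U : set (km_alg g)) tau gam : lie_subalgebra U ->
  real_roots g tau -> rsp tau `<=` U -> rsp (- tau) `<=` U ->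
  rsp (reflection tau gam) `<=` U -> rsp gam `<=` U.
Proof.
move=> hU rt ut unt ug x wx.
have [r [r' [_ rK _ rU rw]]] := reflection_auto_sub hU rt ut unt.
by rewrite -(rK x); apply: rU; apply: ug; case: (rw _ _ wx).
Qed.

Lemma root_gen_simple_system Psi : subroot_system Psi ->
  root_gen Psi = root_gen (simple_system Psi).
Proof.
move=> hP; apply/seteqP; split; last first.
  apply: root_gen_min; first exact: lie_gen_subalg.
  by move=> lam [[pl _] _]; split; apply: root_gen_sub; [left|right; rewrite opprK].
have hU : lie_subalgebra (root_gen (simple_system Psi)) := lie_gen_subalg _.
have H N gam : (ht gam < N)%N -> (Psi `&` pos_roots g) gam ->
    rsp gam `<=` root_gen (simple_system Psi) /\
    rsp (- gam) `<=` root_gen (simple_system Psi).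
  elim: N gam => // N IH gam hN og.
  have [sg|ns] := pselect (simple_system Psi gam).
    by split; apply: root_gen_sub; [left|right; rewrite opprK].
  have [tau [ot orr lt ltr]] := nonsimple_descent hP og ns.
  have [t1 t2] := IH _ (leq_trans lt (ltnSE hN)) ot.
  have [r1 r2] := IH _ (leq_trans ltr (ltnSE hN)) orr.
  have rt := Psi_real hP ot.1.
  by split; apply: (rsp_reflection_sub hU rt t1 t2) => //; rewrite reflectionrN.
apply: root_gen_min => // lam pl.
have rl := Psi_root hP pl.
case: (root_sign rl) => q.
  by apply: (H _ _ (ltnSn _)).
have pn := PsiN hP pl.
have [] : rsp (- lam) `<=` root_gen (simple_system Psi) /\
  rsp (- - lam) `<=` root_gen (simple_system Psi).
  apply: (H _ _ (ltnSn _)); split=> //; split=> //; exact: (Psi_root hP pn).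
by rewrite opprK.
Qed.

(** [Sigma] may contain roots of both signs here; which alternative holds is decided only once its
    elements are known to be positive. *)
Lemma root_gen_weights Sigma lam x : pi_system Sigma ->
  root_gen Sigma x -> rsp lam x -> x != 0 ->
  list_span Sigma lam \/ list_span Sigma (- lam).
Proof.
move=> [_ hS] gx wx x0; apply: contrapT => nl; case/eqP: x0.
have ic := iota_comm km.
pose E := \bigcup_(a in Sigma) rsp a; pose F := \bigcup_(a in Sigma) rsp (- a).
have sub : root_gen Sigma `<=` lie_gen (rsp 0 `|` E `|` F).
  apply: root_gen_min; first exact: lie_gen_subalg.
  move=> a Sa; split=> y wy; apply: sub_lie_gen; last by right; exists a.
  by left; right; exists a.
have tri := @lie_gen_triangular _ _ E F (rsp 0) (wsp_subspace (cartan_inj g) 0).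
have wspL0 a b y z c : rsp a y -> rsp b z -> c = a + b -> rsp c (lie y z).
  by move=> wy wz ->; apply: (@wspL _ _ _ (cartan_inj g)).
have [] := tri _ _ _ _ _ (sub _ gx).
- by move=> y z wy wz; apply: wspL0 wy wz _; rewrite addr0.
- move=> y z [a Sa wy] [b Sb wz]; have wyz := wspL0 _ _ _ _ _ wy wz (erefl _).
  have [ab|ab] := eqVneq a b; first by move: wyz; rewrite ab subrr.
  have -> : lie y z = 0; last exact: (subspace0 (wsp_subspace (cartan_inj g) 0)).
  apply: contrapT => /eqP n0; apply: (hS _ _ Sa Sb); split; first by rewrite subr_eq0.
  by exists (lie y z).
- move=> y z wy [a Sa wz]; apply: sub_lie_gen; exists a => //.
  by apply: wspL0 wy wz _; rewrite add0r.
- move=> y z wy [a Sa wz]; apply: sub_lie_gen; exists a => //.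
  by apply: wspL0 wy wz _; rewrite add0r.
move=> a [b [c [ha hb hc e]]].
pose P : set V := [set mu | list_span Sigma mu \/ list_span Sigma (- mu)].
have gen (sgn : bool) (G : set (km_alg g)) : (G `<=` wsum (cartan_inj g)
    [set mu | list_span Sigma ((-1) ^+ sgn *: mu)]) ->
    lie_gen G `<=` wsum (cartan_inj g) P.
  move=> hG y hy; apply: (wsum_mono (P := [set mu | list_span Sigma ((-1) ^+ sgn *: mu)])).
    by move=> mu /=; case: (sgn); rewrite ?scaleN1r ?scale1r; [right|left].
  move: y hy; apply: lie_gen_min => //; split; first exact: wsum_subspace.
  move=> y z; apply: wsumL => m m' h1 h2 /=; rewrite scalerDr; exact: list_spanD.
have hW := wsum_subspace (cartan_inj g) P.
apply: (@wsum_indep _ _ _ (cartan_inj g) P lam x) => //; rewrite e.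
apply: (subspaceD hW); first apply: (subspaceD hW).
- apply: (gen true F) ha => y [m Sm wy]; apply: wsum_sub wy => /=.
  by rewrite scaleN1r opprK; apply: list_span_sub.
- by apply: wsum_sub hb; left; apply: list_span0.
- apply: (gen false E) hc => y [m Sm wy]; apply: wsum_sub wy => /=.
  by rewrite scale1r; apply: list_span_sub.
Qed.

Lemma roots_ofP (s : set (km_alg g)) lam : roots_of s lam <->
  roots g lam /\ exists x, [/\ rsp lam x, s x & x != 0].
Proof.
split=> [[rl H]|[rl [x [wx sx /eqP x0]]]]; last first.
  by split=> // H; apply: x0; apply: H.
split=> //; apply: contrapT => H'; apply: H => x [wx sx] /=.
by apply: contrapT => /eqP x0; apply: H'; exists x.
Qed.

Lemma list_span_Qp Sigma lam : Sigma `<=` pos_roots g -> list_span Sigma lam -> Qp lam.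
Proof.
move=> hS [t [ht ->]]; rewrite big_seq.
by apply: (big_ind Qp); [exact: Qp0|move=> *; exact: QpD|move=> x /ht /hS []].
Qed.

Lemma simple_real_roots Psi lam :
  real_closed_subroot_system Psi ->
  roots_of (root_gen (simple_system Psi)) lam -> real_roots g lam -> Psi lam.
Proof.
move=> [_ hP1 hP2 hcl].
have hP : subroot_system Psi by split=> // tau mu; apply: hP2.
have pis := simple_pi_system hP hcl.
set U := root_gen _; have hU : lie_subalgebra U := lie_gen_subalg _.
have sposs : simple_system Psi `<=` pos_roots g by move=> a [[]].
have H N (b : bool) gam : (ht ((-1) ^+ b *: gam) < N)%N -> roots_of U gam ->
    real_roots g gam -> list_span (simple_system Psi) ((-1) ^+ b *: gam) -> Psi gam.
  elim: N gam => // N IH gam hN rof rg hl.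
  set s : K := (-1) ^+ b in hN hl *.
  have ss : s * s = 1 by rewrite -expr2 sqrr_sign.
  have [t [ht_ et]] := hl.
  have qs : Qp (s *: gam) by apply: list_span_Qp hl.
  have rsg : real_roots g (s *: gam).
    by rewrite /s; case: (b); rewrite ?scaleN1r ?scale1r //; apply: real_rootN.
  have [a [at_ da]] : exists a, a \in t /\ 0 < df (s *: gam) a.
    apply: contrapT => /forallNP na; have [_] := rsg.
    have -> : df (s *: gam) (s *: gam) = \sum_(x <- t) df (s *: gam) x.
      rewrite [X in df X _]et dfE sum_lfunE; apply: eq_bigr => x _.
      by rewrite -dfE df_sym.
    rewrite le_gtF // big_seq; apply: sumr_le0 => x xt.
    have sx := ht_ _ xt; have ox := sx.1.
    apply: pairing_nonpos; [exact: (hP1 _ ox.1)|exact: rsg.1|].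
    by move=> d0; apply: (na x).
  have sa := ht_ _ at_; have oa := sa.1; have ra := Psi_real hP oa.1.
  have [p hp] := pairing_pos ra rsg.1 da.
  set mu := reflection a gam.
  have smu : s *: mu = s *: gam - a *+ p.+1.
    by rewrite /mu -reflectionrZ reflectionE hp scaler_nat.
  have rmu : real_roots g mu by apply: real_reflection_real.
  have romu : roots_of U mu.
    apply/roots_ofP; split; first by case: rmu.
    have [_ [x [wx Ux x0]]] := (roots_ofP _ _).1 rof.
    have ua : rsp a `<=` U by apply: root_gen_sub; left.
    have una : rsp (- a) `<=` U by apply: root_gen_sub; right; rewrite opprK.
    have [r [r' [rK _ r0 rU rw]]] := reflection_auto_sub hU ra ua una.
    exists (r x); split; [by case: (rw _ _ wx)|exact: rU|].
    apply: contra_neq x0 => rx; rewrite -(rK x) rx -[in LHS]r0 rK //.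
  have [_ [x [wx Ux x0]]] := (roots_ofP _ _).1 romu.
  have back : gam = reflection a mu by rewrite reflectionK // real_df_neq0.
  have [lmu|lmu] : list_span (simple_system Psi) (s *: mu) \/
      list_span (simple_system Psi) (- (s *: mu)).
    have := root_gen_weights pis Ux wx x0.
    by rewrite /s; case: (b); rewrite ?scaleN1r ?scale1r ?opprK //; case; [right|left].
  - rewrite back; apply: hP2; first exact: oa.1.
    apply: IH => //.
    have qmu : Qp (s *: mu) by apply: list_span_Qp lmu.
    have e : s *: gam = s *: mu + a *+ p.+1 by rewrite smu addrNK.
    have qa := oa.2.2; have a0 := pos_ht_gt0 oa.2.
    rewrite e htD // in hN; last exact: QpMn.
    have : (0 < ht (a *+ p.+1))%N by rewrite htMn // muln_gt0 a0.
    by rewrite -/s => a1; apply: leq_trans (ltnSE hN); rewrite -addn1 leq_add2l.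
  (* Now the multiple (p+1) a equals s gam + (-s mu), a sum of elements of Pi(Psi).
     Indecomposability forces all of them to be [a], so [gam] is proportional to [a]. *)
  have [t' [ht' et']] := lmu.
  have all_a y : y \in t -> y = a.
    move=> yt; apply: (@simple_indecomposable _ _ Psi a p.+1 (t ++ t')) => //.
    - by move=> z; rewrite mem_cat => /orP [/ht_|/ht'] [].
    - by rewrite big_cat /= -et -et' smu opprB addrC addrNK.
    - by rewrite mem_cat yt.
  have sga : s *: gam = a *+ size t.
    rewrite et big_seq (eq_bigr (fun=> a)); last by move=> y /all_a.
    by rewrite -big_seq big_const_seq count_predT iter_addr_0.
  have ga : gam = (s * (size t)%:R) *: a.
    by rewrite -scalerA scaler_nat -sga scalerA ss scale1r.
  by case: (real_multiple ra rg ga) => ->; [exact: oa.1|exact: PsiN oa.1].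
move=> rof rl; have [_ [x [wx Ux x0]]] := (roots_ofP _ _).1 rof.
case: (root_gen_weights pis Ux wx x0) => l.
  by apply: (H _ false _ (ltnSn _)) => //; rewrite scale1r.
by apply: (H _ true _ (ltnSn _)) => //; rewrite scaleN1r.
Qed.

End Generation.

(** Part (2) is stated for pi-systems of positive roots. For Sigma = {-alpha_i} the positive root
    alpha_i belongs to g(Sigma) but not to the nonnegative span of Sigma, so positivity is what
    matches the two signs. *)
Theorem mainTheorem2 (R : realType) (g : symKacMoody R[i]) :
  (forall Psi : set 'Hom(cartan g, R[i]^o), real_closed_subroot_system Psi ->
     root_gen Psi = root_gen (simple_system Psi)) /\
  (forall Sigma : set 'Hom(cartan g, R[i]^o), pi_system Sigma ->
     Sigma `<=` pos_roots g ->
     roots_of (root_gen Sigma) `&` pos_roots g `<=` Zplus_span Sigma /\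
     roots_of (root_gen Sigma) `&` neg_roots g `<=` Zminus_span Sigma) /\
  (forall Psi : set 'Hom(cartan g, R[i]^o), real_closed_subroot_system Psi ->
     Psi = roots_of (root_gen Psi) `&` real_roots g).
Proof.
have sub Psi : real_closed_subroot_system Psi -> @subroot_system _ g Psi.
  by move=> [_ h1 h2 _]; split=> // tau lam; apply: h2.
split; first by move=> Psi /sub; apply: root_gen_simple_system.
split=> [Sigma pis pos|Psi hP].
  split=> lam [/roots_ofP [rl [x [wx Ux x0]]] [rl' ql]].
    apply: list_span_Zplus; case: (root_gen_weights pis Ux wx x0) => // l.
    by case: (pos_not_neg rl ql); apply: list_span_Qp l.
  apply: list_span_Zminus; case: (root_gen_weights pis Ux wx x0) => // l.
  by case: (pos_not_neg rl (list_span_Qp pos l)).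
apply/seteqP; split=> lam.
  move=> pl; have rl : real_roots g lam by case: hP => _ h1 _ _; apply: h1.
  split=> //; apply/roots_ofP; case: rl => [[l0 [x wx x0]] nl]; split; first by split=> //; exists x.
  by exists x; split=> //; apply: root_gen_sub wx; left.
move=> [rof rl]; apply: simple_real_roots => //.
by rewrite -root_gen_simple_system //; apply: sub.
Qed.
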